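(* The following statements are equivalent: (1) every strong measure zero set of real numbers is countable (Borel's Conjecture); (2) every strong measure zero metric space is countable; (3) every Rothberger bounded subset of a topological group of countable weight is countable; (4) every subgroup of the additive group of real numbers all of whose finite powers are Rothberger spaces is countable.
   Context: All topological groups and spaces are assumed Tychonoff. A metric space $(X,d)$ has strong measure zero if for every sequence $(\epsilon_n:n<\omega)$ of positive reals there are open sets $U_n$ of $d$-diameter at most $\epsilon_n$ with $X=\bigcup_n U_n$. A subset $X$ of a topological group $(G,* )$ is Rothberger bounded if for every sequence $(U_n:n<\omega)$ of open neighborhoods of the identity there are $g_n\in G$ with $X\subseteq\bigcup_n g_n*U_n$. A topological space is a Rothberger space if for every sequence $(\mathcal U_n:n<\omega)$ of open covers there are $U_n\in\mathcal U_n$ such that $\{U_n:n<\omega\}$ covers the space. *)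

(* Defs.v *)
From HB Require Import structures.
From mathcomp Require Import all_boot all_order all_algebra.
From mathcomp Require Import all_classical all_reals all_analysis.
Set Implicit Arguments. Unset Strict Implicit. Unset Printing Implicit Defensive.
Import Order.TTheory GRing.Theory Num.Theory.
Local Open Scope classical_set_scope.
Local Open Scope ring_scope.

Definition is_metric (R : realType) (T : Type) (d : T -> T -> R) :=
  [/\ forall x y, 0 <= d x y,
      forall x y, d x y = 0 <-> x = y,
      forall x y, d x y = d y x &
      forall x y z, d x z <= d x y + d y z].

Definition metric_open_in (R : realType) (T : Type) (d : T -> T -> R)
    (A U : set T) :=
  U `<=` A /\
  forall x, U x -> exists2 r : R, 0 < r & [set y | A y /\ d x y < r] `<=` U.

Definition diam_le (R : realType) (T : Type) (d : T -> T -> R) (U : set T)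
    (e : R) := forall x y, U x -> U y -> d x y <= e.

Definition strong_measure_zero (R : realType) (T : Type) (d : T -> T -> R)
    (A : set T) :=
  forall eps : nat -> R, (forall n, 0 < eps n) ->
  exists U : nat -> set T,
    (forall n, metric_open_in d A (U n) /\ diam_le d (U n) (eps n)) /\
    A `<=` \bigcup_n U n.

Definition is_topological_group (G : topologicalType) (mul : G -> G -> G)
    (inv : G -> G) (e : G) :=
  [/\ forall x y z, mul x (mul y z) = mul (mul x y) z,
      forall x, mul e x = x /\ mul x e = x,
      forall x, mul (inv x) x = e /\ mul x (inv x) = e,
      continuous (fun p : G * G => mul p.1 p.2) &
      continuous inv].

Definition tychonoff (T : topologicalType) :=
  hausdorff_space T /\ completely_regular_space T.

Definition rothberger_bounded (G : topologicalType) (mul : G -> G -> G)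
    (e : G) (X : set G) :=
  forall U : nat -> set G, (forall n, open (U n) /\ U n e) ->
  exists g : nat -> G, X `<=` \bigcup_n [set mul (g n) u | u in U n].

(** The subspace [A] of [T] is a Rothberger space.  Open sets of the
    subspace [A] are the traces [V `&` A] of open sets [V] of [T], so an
    open cover of [A] is given by a family of open sets of [T] covering [A]. *)
Definition rothberger_subspace (T : topologicalType) (A : set T) :=
  forall Us : nat -> set (set T),
    (forall n, (forall V, Us n V -> open V) /\ A `<=` \bigcup_(V in Us n) V) ->
  exists V : nat -> set T, (forall n, Us n (V n)) /\ A `<=` \bigcup_n V n.

Definition add_subgroup (R : realType) (H : set R) :=
  [/\ H 0, forall x y, H x -> H y -> H (x + y) & forall x, H x -> H (- x)].

(** The n-th power [H^n], as a subset of [R^n] = 'rV[R^o]_n (product topology). *)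
Definition set_pow (R : realType) (n : nat) (H : set R) : set 'rV[R^o]_n :=
  [set v | forall i, H (v ord0 i)].

Definition BC1 (R : realType) :=
  forall X : set R, strong_measure_zero (fun x y : R => `|x - y|) X ->
  countable X.

Definition BC2 (R : realType) :=
  forall (T : Type) (d : T -> T -> R), is_metric d ->
  strong_measure_zero d [set: T] -> countable [set: T].

Definition BC3 :=
  forall (G : topologicalType) (mul : G -> G -> G) (inv : G -> G) (e : G),
  is_topological_group mul inv e -> tychonoff G -> @second_countable G ->
  forall X : set G, rothberger_bounded mul e X -> countable X.

Definition BC4 (R : realType) :=
  forall H : set R, add_subgroup H ->
  (forall n : nat, (0 < n)%N -> @rothberger_subspace 'rV[R^o]_n (@set_pow R n H)) ->
  countable H.

(* Main.v *)
(* (1) => (2): let W be an uncountable subset of a strong measure zero metric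
   space, well-ordered with countable initial segments, and let f_n be the
   truncated distances to the points of a countable dense set.  The Lipschitz
   maps F_t = sum_n t^n f_n, 0 < t <= 1/3, have strong measure zero images, so by
   (1) none of them is injective on W.  A nonzero power series with bounded
   coefficients has finitely many zeros in (0, 1/3], so two given points of W are
   identified by F_t for finitely many t only.  Hence (0, 1/3] is an increasing
   union over W of countable sets; this is the continuum hypothesis in disguise,
   and yields a Luzin set, i.e. an uncountable strong measure zero set of reals.
   (2) => (3): metrize the left uniformity.
   (4) => (1): let W be as above inside an uncountable strong measure zero set of
   reals.  If every family of functions nat -> nat indexed by W is bounded for
   eventual domination, then all powers of W have strong measure zero and are
   Rothberger.  Otherwise an unbounded family can be turned into a scale indexed
   by W; the orbits of 0 under its members, together with the finite sets, form
   a set of reals, all powers of which are Rothberger because the scale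
   concentrates them on the finite sets.  In both cases the group generated is
   uncountable, and its powers are countable unions of continuous images of
   powers of the generating set. *)
From HB Require Import structures.
Require Import Defs.
From mathcomp Require Import all_boot all_order all_algebra.
From mathcomp Require Import all_classical all_reals all_analysis.
From mathcomp Require Import wochoice ring lra zify.
Set Implicit Arguments. Unset Strict Implicit. Unset Printing Implicit Defensive.
Import Order.TTheory GRing.Theory Num.Theory.
Import numFieldNormedType.Exports.
Local Open Scope classical_set_scope.
Local Open Scope ring_scope.

(** * Power series with bounded coefficients *)

Section PowerSeries.
Variable R : realType.
Implicit Types (t M : R) (c : nat -> R).

(** The bound 1/3 caps the geometric sum at 3/2. Dividing out a zero thus costs a factor 3/2 and
    gains a factor 1/3, which halves the bound on the constant coefficient. *)
Definition pos_le_third t := 0 < t /\ t <= 1 / 3.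

Definition psum t c : R := limn (series (fun n => c n * t ^+ n)).

Definition bounded_by M c := forall n, `|c n| <= M.

Lemma pos_le_third_third : pos_le_third (1 / 3).
Proof. by split; lra. Qed.

Lemma psum_normed_cvg t M c : pos_le_third t -> bounded_by M c ->
  cvgn [normed series (fun n => c n * t ^+ n)].
Proof.
move=> [t0 t3] cM; apply: (@series_le_cvg _ _ (geometric M t)).
- by move=> n /=.
- move=> n /=; rewrite mulr_ge0 ?exprn_ge0 ?(ltW t0)//.
  exact: le_trans (cM 0%N).
- move=> n /=; rewrite normrM (ger0_norm (exprn_ge0 _ (ltW t0))).
  by rewrite ler_wpM2r// exprn_ge0// ltW.
- by apply: is_cvg_geometric_series; rewrite ger0_norm; lra.
Qed.

Lemma psum_cvg t M c : pos_le_third t -> bounded_by M c ->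
  cvgn (series (fun n => c n * t ^+ n)).
Proof. by move=> st cM; apply: normed_cvg; exact: psum_normed_cvg st cM. Qed.

Lemma psum_bound t M c : pos_le_third t -> bounded_by M c ->
  `|psum t c| <= 3 / 2 * M.
Proof.
move=> st cM; have [t0 t3] := st.
have M0 : 0 <= M by exact: le_trans (cM 0%N).
have gc : `|t| < 1 by rewrite ger0_norm; lra.
apply: le_trans (lim_series_norm (psum_normed_cvg st cM)) _.
apply: (@le_trans _ _ (limn (series (geometric M t)))).
  apply: lim_series_le.
  - exact: psum_normed_cvg st cM.
  - exact: is_cvg_geometric_series.
  - move=> n /=; rewrite normrM (ger0_norm (exprn_ge0 _ (ltW t0))).
    by rewrite ler_wpM2r// exprn_ge0// ltW.
rewrite (cvg_lim _ (cvg_geometric_series gc))//.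
rewrite ler_pdivrMr; last lra.
by nra.
Qed.

Lemma psumB t M M' c c' : pos_le_third t -> bounded_by M c -> bounded_by M' c' ->
  psum t (fun n => c n - c' n) = psum t c - psum t c'.
Proof.
move=> st cM cM'; rewrite /psum.
rewrite -lim_seriesB; [|exact: psum_cvg st cM|exact: psum_cvg st cM'].
congr (limn (series _)); apply/funext => n.
by rewrite mulrBl.
Qed.

Lemma psumZ t M c k : pos_le_third t -> bounded_by M c ->
  psum t (fun n => k * c n) = k * psum t c.
Proof.
move=> st cM; rewrite /psum.
have -> : (fun n => k * c n * t ^+ n) = k *: (fun n => c n * t ^+ n).
  by apply/funext => n; rewrite -mulrA.
by rewrite lim_seriesZ//; exact: psum_cvg st cM.
Qed.

Lemma psum_recl t M c : pos_le_third t -> bounded_by M c ->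
  psum t c = c 0%N + t * psum t (fun n => c n.+1).
Proof.
move=> st cM.
have cM' : bounded_by M (fun n => c n.+1) by move=> n; exact: cM.
apply: cvg_lim => //; rewrite -cvg_shiftS /=.
have -> : (fun n => series (fun n => c n * t ^+ n) n.+1) =
  (fun n => c 0%N + t * series (fun n => c n.+1 * t ^+ n) n).
  apply/funext => n; rewrite /series/= big_nat_recl//= expr0 mulr1.
  congr (_ + _); rewrite big_distrr/=; apply: eq_bigr => i _.
  by rewrite exprS; ring.
apply: cvgD; first exact: cvg_cst.
by apply: cvgM; [exact: cvg_cst|exact: psum_cvg st cM'].
Qed.

Lemma psum_shift t M c k : pos_le_third t -> bounded_by M c ->
  (forall n, (n < k)%N -> c n = 0) ->
  psum t c = t ^+ k * psum t (fun n => c (k + n)%N).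
Proof.
move=> st; elim: k c => [|k IH] c cM c0; first by rewrite expr0 mul1r.
rewrite (psum_recl st cM) c0// add0r IH => [|n|n nk].
- by rewrite mulrA -exprS.
- exact: cM.
- exact: c0.
Qed.

Lemma psum_tail t c k : pos_le_third t -> bounded_by 1 c ->
  (forall n, (n < k)%N -> c n = 0) -> `|psum t c| <= 3 / 2 * (1 / 3) ^+ k.
Proof.
move=> st cM c0; rewrite (psum_shift st cM c0); have [t0 t3] := st.
have : `|psum t (fun n => c (k + n)%N)| <= 3 / 2 * 1.
  by apply: psum_bound => // n; exact: cM.
rewrite normrM (ger0_norm (exprn_ge0 _ (ltW t0))) mulr1 => h.
rewrite mulrC; apply: ler_pM => //; first by rewrite exprn_ge0// ltW.
by apply: lerXn2r; rewrite ?nnegrE; lra.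
Qed.

(* A zero [t0] of the series can be divided out: the quotient has coefficients
   [b] with [c 0 = - t0 * b 0], bounded by [M / (1 - t0)]; so each division
   gains a factor [t0 / (1 - t0) <= 1 / 2]. *)
Lemma psum_zeros c M (s : seq R) : bounded_by M c -> uniq s ->
  (forall t, t \in s -> pos_le_third t /\ psum t c = 0) ->
  `|c 0%N| <= M * (1 / 2) ^+ size s.
Proof.
elim: s c M => [|t0 s IH] c M cM; first by rewrite expr0 mulr1 => _ _; exact: cM.
move=> /= /andP[t0s us] zs.
have [st0 z0] : pos_le_third t0 /\ psum t0 c = 0 by apply: zs; rewrite mem_head.
pose b n := psum t0 (fun m => c (n.+1 + m)%N).
have bM : bounded_by (3 / 2 * M) b.
  by move=> n; apply: psum_bound => // m; exact: cM.
have bS n : c n.+1 = b n - t0 * b n.+1.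
  rewrite /b (@psum_recl t0 M)//.
  rewrite addn0.
  have -> : (fun m => c (n.+1 + m.+1)%N) = (fun m => c (n.+2 + m)%N).
    by apply/funext => m; rewrite addnS.
  by ring.
have c0 : c 0%N = - t0 * b 0%N.
  by move: z0; rewrite (psum_recl st0 cM) => /eqP; rewrite addr_eq0 => /eqP ->;
     rewrite mulNr.
have key t : t \in s -> pos_le_third t /\ psum t b = 0.
  move=> ts; have [st zt] : pos_le_third t /\ psum t c = 0.
    by apply: zs; rewrite inE ts orbT.
  split=> //.
  have bM' : bounded_by (3 / 2 * M) (fun n => b n.+1) by move=> n; exact: bM.
  have E : psum t c = c 0%N + t * (psum t b - t0 * psum t (fun n => b n.+1)).
    rewrite (psum_recl st cM).
    have -> : (fun n => c n.+1) = (fun n => b n - t0 * b n.+1).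
      by apply/funext => n; exact: bS.
    rewrite -(psumZ t0 st bM') (@psumB _ (3 / 2 * M) (`|t0| * (3 / 2 * M)))//.
    by move=> n; rewrite normrM ler_wpM2l.
  have Eb := psum_recl st bM.
  have h : (t - t0) * psum t b = 0.
    by move: E; rewrite zt c0; nra.
  move/eqP: h; rewrite mulf_eq0 subr_eq0 => /orP[/eqP tt|/eqP//].
  by move: t0s; rewrite -tt ts.
have := IH b _ bM us key.
rewrite c0 normrM normrN => h.
have [p0 p3] := st0; rewrite (gtr0_norm p0) exprS.
have := normr_ge0 (b 0%N).
set e := (1 / 2) ^+ size s in h *; set x := `|b 0%N| in h *.
by nra.
Qed.

(** The zero set is in fact finite: after division by [t ^+ k], with [c k] the first nonzero
    coefficient, [N] distinct zeros force [|c k| <= M / 2^N], which fails for large [N]. *)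
Lemma psum_zeros_countable c M : bounded_by M c -> (exists n, c n <> 0) ->
  countable [set t | pos_le_third t /\ psum t c = 0].
Proof.
move=> cM nz.
have nz' : exists n, c n != 0 by case: nz => n /eqP; exists n.
pose k := ex_minn nz'.
have [ck ck0] : c k != 0 /\ forall n, (n < k)%N -> c n = 0.
  rewrite /k; case: ex_minnP => m cm mmin; split=> // n nm.
  by apply/eqP; apply: contraLR nm => /mmin; rewrite -leqNgt.
apply: finite_set_countable; apply: contrapT => inf.
have M0 : 0 <= M by exact: le_trans (cM 0%N).
have [N HN] : exists N, M * (1 / 2) ^+ N < `|c k|.
  have : ((fun n => geometric M (1 / 2 : R) n) @ \oo --> (0 : R)).
    by apply: cvg_geometric; rewrite ger0_norm; lra.
  move/cvgrPdist_lt => /(_ `|c k|); rewrite normr_gt0 ck => /(_ isT)[N _ hN].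
  exists N; have /= := hN N (leqnn _); rewrite sub0r normrN.
  by apply: le_lt_trans; exact: ler_norm.
have [B Bsub NB] := infinite_set_fset N inf.
have h : `|c k| <= M * (1 / 2) ^+ size (finmap.enum_fset B).
  rewrite -[k in c k]addn0.
  apply: (@psum_zeros (fun n => c (k + n)%N)) => //.
  - exact: finmap.fset_uniq.
  - move=> t tB; have [st z] := Bsub t tB; split=> //.
    move: z; rewrite (psum_shift st cM ck0) => /eqP; rewrite mulf_eq0.
    rewrite expf_eq0; case: st => t0 _.
    by rewrite (gt_eqF t0) andbF/= => /eqP.
suff : M * (1 / 2) ^+ size (finmap.enum_fset B) <= M * (1 / 2) ^+ N.
  by move: h HN; lra.
rewrite ler_wpM2l// ler_wiXn2l//; lra.
Qed.

End PowerSeries.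

(** * Countable sets and well-orders of type omega_1 *)

Lemma subset_countable T (A B : set T) : A `<=` B -> countable B -> countable A.
Proof. by move=> /subset_card_le; exact: sub_countable. Qed.

Lemma image_countable T U (f : T -> U) (A : set T) :
  countable A -> countable (f @` A).
Proof. exact: sub_countable (card_image_le _ _). Qed.

Lemma countable_image_inj T U (f : T -> U) (A : set T) :
  {in A &, injective f} -> countable (f @` A) -> countable A.
Proof.
move=> finj /countable_injP[g ginj]; apply/countable_injP; exists (g \o f).
move=> x y xA yA /= gxy; apply: finj => //.
by apply: ginj gxy; rewrite inE; [exists x|exists y] => //; exact/set_mem.
Qed.

Lemma countable_enum T (A : set T) : countable A -> A !=set0 ->
  exists u : nat -> T, A = range u.
Proof.
move=> /pfcard_geP[-> [//]|/unsquash f] _.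
exists f; apply/seteqP; split=> [x /(@surj _ _ _ _ f)[n _ <-]|_ [n _ <-]].
  by exists n.
exact: funS.
Qed.

(** The strict part of the relation from the well-ordering principle. Unique least elements of sets
    of at most three points give asymmetry, trichotomy and transitivity. *)
Lemma exists_well_order (T : Type) : exists lt : T -> T -> Prop,
  [/\ well_founded lt, forall x y, [\/ lt x y, x = y | lt y x] &
      forall x y z, lt x y -> lt y z -> lt x z].
Proof.
have [r wr] := well_ordering_principle {classic T}.
pose lt (x y : {classic T}) := r x y /\ x <> y.
have wmin (A : set {classic T}) : A !=set0 ->
    exists2 z, A z & forall x, A x -> x <> z -> lt z x.
  move=> [a Aa]; have [|z [[zA zmin] _]] := wr [pred x | `[< A x >]].
    by exists a; apply/asboolP.
  exists z; first exact/asboolP.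
  by move=> x Ax xz; split; [apply: zmin; exact/asboolP|exact/nesym].
have asym x y : lt x y -> lt y x -> False.
  move=> [xy xny] [yx _].
  have [|z [_ zuniq]] := wr [pred u | `[< u = x \/ u = y >]].
    by exists x; apply/asboolP; left.
  have rxx u : r u u.
    have [|v [[/asboolP vu vmin] _]] := wr [pred w | `[< w = u >]].
      by exists u; apply/asboolP.
    by rewrite vu in vmin; apply: vmin; exact/asboolP.
  have zx : z = x.
    by apply: zuniq; split; [apply/asboolP; left|move=> u /asboolP[->|->]].
  have zy : z = y.
    by apply: zuniq; split; [apply/asboolP; right|move=> u /asboolP[->|->]].
  by apply: xny; rewrite -zx.
have tri x y : [\/ lt x y, x = y | lt y x].
  have [->|/eqP xy] := eqVneq x y; first by constructor 2.
  have [|z [->|->] zmin] := wmin [set u | u = x \/ u = y].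
  - by exists x; left.
  - by constructor 1; apply: zmin; [right|exact/nesym].
  - by constructor 3; apply: zmin; [left|].
exists lt; split; [|exact: tri|].
  move=> x; apply: contrapT => nx.
  have [|z nz zmin] := wmin [set u | ~ Acc lt u]; first by exists x.
  apply: nz; constructor => y yz; apply: contrapT => ny.
  apply: (asym y z) => //; apply: zmin => // yz'.
  by case: yz; rewrite yz'.
move=> x y z xy yz.
have [|u uxyz umin] := wmin [set u | [\/ u = x, u = y | u = z]].
  by exists x; constructor 1.
have [//|xz|zx] := tri x z; first by rewrite xz in xy; case: (asym _ _ xy yz).
case: uxyz => e; subst u.
- by case: (asym z x zx); apply: umin; [constructor 3|move=> e; case: zx => _; exact].
- by case: (asym x y xy); apply: umin; [constructor 1|case: xy].
- by case: (asym y z yz); apply: umin; [constructor 2|case: yz].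
Qed.

(** A stand-in for the ordinal omega_1: [lt] orders all of [T], but countability of initial segments
    is asked only inside [W]. *)
Definition omega1_like T (W : set T) (lt : T -> T -> Prop) :=
  [/\ ~ countable W, well_founded lt,
      forall x y, [\/ lt x y, x = y | lt y x],
      forall x y z, lt x y -> lt y z -> lt x z &
      forall w, W w -> countable [set v | W v /\ lt v w]].

(** [W] collects the points of [X] with countably many predecessors in [X]. If [W] were countable,
    the least point of [X] outside [W] would have all its predecessors in [W] and so belong to
    [W]. *)
Lemma exists_omega1_like T (X : set T) : ~ countable X ->
  exists W lt, W `<=` X /\ omega1_like W lt.
Proof.
move=> ncX; have [lt [wf tri tr]] := exists_well_order T.
pose W := [set x | X x /\ countable [set v | X v /\ lt v x]].
exists W, lt; split=> [x []//|]; split=> //; last first.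
  by move=> w [_]; apply: subset_countable => v [[]].
move=> cW; have [x Xx nWx] : exists2 x, X x & ~ W x.
  apply: contrapT => h; apply: ncX; apply: subset_countable cW => x Xx.
  by apply: contrapT => nW; apply: h; exists x.
elim/(well_founded_ind wf): x Xx nWx => x IH Xx nWx; apply: nWx; split=> //.
apply: subset_countable cW => v [Xv vx].
by apply: contrapT => nWv; exact: IH vx Xv nWv.
Qed.

(** Regularity of omega_1: if [D] were cofinal, [W] would be the union of countably many countable
    closed initial segments. *)
Lemma omega1_bound T (W : set T) lt (D : set T) : omega1_like W lt ->
  D `<=` W -> countable D -> exists2 w, W w & forall v, D v -> lt v w.
Proof.
move=> [ncW wf tri tr cI] DW cD; apply: contrapT => h; apply: ncW.
apply: (@subset_countable _ _
  (\bigcup_(d in D) ([set v | W v /\ lt v d] `|` [set d]))); last first.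
  apply: bigcup_countable => // d Dd; rewrite setUC.
  have -> : [set d] `|` [set v | W v /\ lt v d] =
      \bigcup_b (if b then [set d] else [set v | W v /\ lt v d]).
    apply/seteqP; split=> [x [xd|xd]|x [[] _ xd]]; by
      [exists true|exists false|left|right].
  by apply: bigcup_countable => // -[] _ //; exact/cI/DW.
move=> w Ww; apply: contrapT => nw; apply: h; exists w => // v Dv.
have [//|e|wv] := tri v w.
  by exfalso; apply: nw; exists v => //; right.
by exfalso; apply: nw; exists v => //; left.
Qed.

(** * Strong measure zero sets *)

Section StrongMeasureZero.
Variable R : realType.

(** Openness comes for free: a set of diameter [eps / 3], enlarged by radius [eps / 3], is open of
    diameter at most [eps]. *)
Lemma strong_measure_zero_covers T (d : T -> T -> R) (A : set T) :
  is_metric d ->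
  (forall eps : nat -> R, (forall n, 0 < eps n) -> exists S : nat -> set T,
    (forall n, diam_le d (S n) (eps n)) /\ A `<=` \bigcup_n S n) ->
  strong_measure_zero d A.
Proof.
move=> [d0 deq dC dT] h eps eps0.
have [|S [Sd AS]] := h (fun n => eps n / 3); first by move=> n; rewrite divr_gt0.
exists (fun n => [set y | A y /\ exists2 x, S n x & d x y < eps n / 3]).
split; last first.
  move=> x Ax; have [n _ Sx] := AS _ Ax; exists n => //; split=> //.
  by exists x => //; rewrite (deq x x).2// divr_gt0.
move=> n; split.
  split=> [x []//|x [Ax [z Sz zx]]].
  exists (eps n / 3 - d z x); first by rewrite subr_gt0.
  move=> y [Ay xy]; split=> //; exists z => //.
  by have := dT z x y; lra.
move=> y y' [_ [x Sx xy]] [_ [x' Sx' xy']].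
have := Sd n _ _ Sx Sx'.
have := dT y x y'; have := dT x x' y'; rewrite (dC y x); lra.
Qed.

Lemma strong_measure_zero_lipschitz T T' (d : T -> T -> R) (d' : T' -> T' -> R)
    (K : R) (f : T -> T') (A B : set T) :
  is_metric d' -> 0 < K -> (forall x y, d' (f x) (f y) <= K * d x y) ->
  B `<=` A -> strong_measure_zero d A -> strong_measure_zero d' (f @` B).
Proof.
move=> md' K0 fK BA smz; apply: strong_measure_zero_covers => // eps eps0.
have [|U [Ud AU]] := smz (fun n => eps n / K); first by move=> n; rewrite divr_gt0.
exists (fun n => f @` U n); split.
  move=> n _ _ [x Ux <-] [y Uy <-]; apply: le_trans (fK _ _) _.
  by have [_ /(_ _ _ Ux Uy)] := Ud n; rewrite ler_pdivlMr// mulrC.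
by move=> _ [x Bx <-]; have [n _ Ux] := AU _ (BA _ Bx); exists n => //; exists x.
Qed.

Lemma is_metric_dist : is_metric (fun x y : R => `|x - y|).
Proof.
split=> //.
- move=> x y; split=> [/eqP|->]; last by rewrite subrr normr0.
  by rewrite normr_eq0 subr_eq0 => /eqP.
- by move=> x y; rewrite distrC.
- by move=> x y z; rewrite (le_trans _ (ler_normD _ _))// addrA subrK.
Qed.

Lemma exists_natSinv_lt (e : R) : 0 < e -> exists n, n.+1%:R^-1 < e.
Proof.
move=> e0; have [N _ hN] := near_infty_natSinv_lt (PosNum e0).
by exists N; apply: (hN N (leqnn N)).
Qed.

(** * Coding subsets and self-maps of nat by reals *)

Definition char_seq (a : set nat) (n : nat) : R := (`[< a n >])%:R.

Definition cantor_real (a : set nat) : R := psum (1 / 3) (char_seq a).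

Lemma char_seq_bounded a : bounded_by 1 (char_seq a).
Proof. by move=> n; rewrite /char_seq; case: asboolP; rewrite ?normr1 ?normr0. Qed.

Lemma char_seqB_bounded a b : bounded_by 1 (fun n => char_seq a n - char_seq b n).
Proof.
move=> n; rewrite /char_seq; case: asboolP => _; case: asboolP => _ /=;
  by rewrite ?subrr ?subr0 ?sub0r ?normrN ?normr1 ?normr0.
Qed.

(** The difference of two codes is a series vanishing at 1/3 whose first nonzero coefficient is 1 or
    -1. After the shift to that coefficient, [psum_zeros] with this single zero bounds it by 1/2. *)
Lemma cantor_real_inj : injective cantor_real.
Proof.
move=> a b ab; apply: contrapT => nab.
have nz : exists n, char_seq a n - char_seq b n != 0.
  apply: contrapT => h; apply: nab; apply/seteqP; split=> n xn;
    apply: contrapT => nxn; apply: h; exists n.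
  - by rewrite /char_seq (asboolT xn) (asboolF nxn) subr0 oner_neq0.
  - by rewrite /char_seq (asboolT xn) (asboolF nxn) sub0r oppr_eq0 oner_neq0.
have cB := char_seqB_bounded a b.
have z : psum (1 / 3) (fun n => char_seq a n - char_seq b n) = 0.
  rewrite (@psumB _ _ 1 1); [|exact: pos_le_third_third|exact: char_seq_bounded..].
  by rewrite -/(cantor_real a) ab subrr.
case: (ex_minnP nz) => k ck kmin.
have ck0 n : (n < k)%N -> char_seq a n - char_seq b n = 0.
  by move=> nk; apply/eqP; apply: contraLR nk => /kmin; rewrite -leqNgt.
move/eqP: z; rewrite (psum_shift (@pos_le_third_third R) cB ck0) mulf_eq0 expf_eq0.
have -> : ((1 / 3 : R) == 0) = false by apply: gt_eqF; lra.
rewrite andbF /=.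
move=> /eqP z.
have : `|char_seq a k - char_seq b k| <= 1 * (1 / 2) ^+ size [:: 1 / 3 : R].
  rewrite -[k]addn0.
  apply: (@psum_zeros _ (fun n => char_seq a (k + n)%N - char_seq b (k + n)%N)) => //.
  by move=> t; rewrite inE => /eqP ->; split=> //; exact: pos_le_third_third.
rewrite /= expr1 mul1r.
move: ck; rewrite /char_seq; case: asboolP => _; case: asboolP => _ /=;
  rewrite ?subrr ?subr0 ?sub0r ?normrN ?normr1 ?eqxx//; lra.
Qed.

Lemma cantor_real_close a b m : (forall n, (n < m)%N -> a n <-> b n) ->
  `|cantor_real a - cantor_real b| <= 3 / 2 * (1 / 3) ^+ m.
Proof.
move=> ab; rewrite /cantor_real -(@psumB _ _ 1 1);
  [|exact: pos_le_third_third|exact: char_seq_bounded..].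
apply: psum_tail; [exact: pos_le_third_third|exact: char_seqB_bounded|].
by move=> n /ab nab; rewrite /char_seq (asbool_equiv_eq nab) subrr.
Qed.

(** The graph of [g] is coded as a set of naturals. Since [cantor_real] has absolute value at most
    3/2, adding 2 and dividing by 12 lands in (0, 1/3], where the power series are evaluated. *)
Definition real_code (g : nat -> nat) : R :=
  (cantor_real [set n | exists i, n = pickle (i, g i)] + 2) / 12.

Lemma real_code_inj : injective real_code.
Proof.
move=> g g' gg'; apply/funext => i.
have : cantor_real [set n | exists i, n = pickle (i, g i)] =
       cantor_real [set n | exists i, n = pickle (i, g' i)].
  by move: gg'; rewrite /real_code; lra.
move=> /cantor_real_inj /seteqP[/(_ (pickle (i, g i)))].
by case=> [|j /(pcan_inj pickleK)[-> ->]] //; exists i.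
Qed.

Lemma real_code_pos_le_third g : pos_le_third (real_code g).
Proof.
have : `|real_code g * 12 - 2| <= 3 / 2 * 1.
  rewrite /real_code mulfVK ?addrK//.
  by apply: psum_bound; [exact: pos_le_third_third|exact: char_seq_bounded].
by rewrite ler_norml => /andP[? ?]; split; lra.
Qed.

End StrongMeasureZero.

(** * Strong measure zero metric spaces *)

Section MetricSpaces.
Variable R : realType.

(** Baire's theorem inside the interval (0, 1/3), for a family indexed by a countable set of reals
    so that it applies to the sets [Z w] below. *)
Lemma baire_countable (A : set R) (F : R -> set R) : countable A ->
  (forall t, A t -> open (F t) /\ dense (F t)) ->
  exists2 x, pos_le_third x & forall t, A t -> F t x.
Proof.
move=> cA oF.
have [A0|/set0P/negP/negPn/eqP A0] := pselect (A !=set0); last first.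
  by exists (1 / 3); [exact: pos_le_third_third|move=> t; rewrite A0].
have [u Au] := countable_enum cA A0.
have /Baire dF n : open (F (u n)) /\ dense (F (u n)).
  by apply: oF; rewrite Au; exists n.
have [||x [/= x3 Fx]] := dF (`]0, (1 / 3)[%classic).
- by exists (1 / 6); rewrite /= in_itv/=; apply/andP; split; lra.
- exact: itv_open.
- exists x; first by move: x3; rewrite in_itv/= => /andP[? ?]; split; lra.
  by move=> t; rewrite Au => -[n _ <-]; exact: Fx.
Qed.

Let q (n : nat) : R := ratr (odflt 0 (unpickle n : option rat)).

(** A set all but countably many of whose points lie in each [nbhd_rat g] has strong measure zero:
    [g] prescribes the radii around the rationals. *)
Let nbhd_rat (g : nat -> nat) : set R := \bigcup_n ball (q n) (g n).+1%:R^-1.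

Let open_nbhd_rat g : open (nbhd_rat g).
Proof. by apply: bigcup_open => n _; exact: ball_open. Qed.

Let dense_nbhd_rat g : dense (nbhd_rat g).
Proof.
move=> D D0 oD; have [x [Dx [r _ rx]]] := @dense_rat R D D0 oD.
exists x; split=> //; exists (pickle r) => //.
rewrite -rx /q pickleK.
exact: ballxx.
Qed.

Let dense_setC1 (t : R) : dense (~` [set t]).
Proof.
move=> D [x Dx] oD.
have /nbhs_ballP[e /= e0 De] : nbhs x D by apply: open_nbhs_nbhs.
have [xt|xt] := pselect (x = t); last by exists x.
exists (x + e / 2); split.
  by apply: De; rewrite /ball/= opprD addNKr normrN gtr0_norm; lra.
by move=> /= h; move: h; rewrite xt; lra.
Qed.

(* The points [x w] chosen below form a Luzin set. *)
Lemma no_omega1_cover (T : Type) (W : set T) lt (Z : T -> set R) :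
  BC1 R -> omega1_like W lt -> (forall w, W w -> countable (Z w)) ->
  (forall v w, W v -> W w -> lt v w -> Z v `<=` Z w) ->
  ~ (@pos_le_third R `<=` \bigcup_(w in W) Z w).
Proof.
move=> bc Wlt cZ mZ Zcov.
have [ncW wf tri tr cI] := Wlt.
(* As codes are injective, [G t] is [nbhd_rat g] when [t] codes [g], and the whole line when [t]
   codes nothing. *)
pose G t := [set x | forall g, real_code R g = t -> nbhd_rat g x].
have oG t : open (G t) /\ dense (G t).
  have [[g gt]|ng] := pselect (exists g, real_code R g = t).
    have -> : G t = nbhd_rat g.
      apply/seteqP; split=> [x|x xg g']; first exact.
      by rewrite -gt => /real_code_inj ->.
    by split.
  have -> : G t = setT.
    by apply/seteqP; split=> // x _ g gt; exfalso; apply: ng; exists g.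
  by split; [exact: openT|move=> D [x Dx] _; exists x].
(* Baire's theorem meets the countably many requirements indexed by [Z w]. Avoiding the points [t]
   themselves is what makes the set of the [x w] uncountable. *)
have /choice[x xP] : forall w, exists x, W w ->
    pos_le_third x /\ forall t, Z w t -> G t x /\ x <> t.
  move=> w; have [Ww|nW] := pselect (W w); last by exists 0.
  have [|x sx xG] := @baire_countable (Z w) (fun t => G t `&` ~` [set t]) (cZ w Ww).
    move=> t _; have [tO tD] := oG t; split.
      by apply: openI => //; rewrite openC; exact: closed_eq.
    move=> D D0 oD; rewrite setIA; apply: dense_setC1; first exact: tD.
    exact: openI.
  by exists x.
have cL : countable (x @` W).
  apply: bc; apply: strong_measure_zero_covers; first exact: is_metric_dist.
  move=> eps eps0.
  (* Even tolerances go to balls around rationals, hence [n.*2]. The code of [g] lies in some [Z v],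
     so [x w] is in [nbhd_rat g] unless [w] precedes [v]; those countably many exceptions use the
     odd tolerances. *)
  have /choice[g gP] : forall n, exists m, m.+1%:R^-1 < eps n.*2 / 2.
    by move=> n; apply: exists_natSinv_lt; rewrite divr_gt0.
  have [v Wv Zv] := Zcov _ (real_code_pos_le_third R g).
  pose C := x @` [set w | W w /\ lt w v].
  have [u uC] : exists u : nat -> R, C `<=` range u.
    have [C0|/set0P/negP/negPn/eqP C0] := pselect (C !=set0); last first.
      by exists (fun=> 0); rewrite C0.
    have [|u ->] := countable_enum _ C0; last by exists u.
    by apply: image_countable; exact: cI.
  exists (fun n => if odd n then [set u n./2] else ball (q n./2) (g n./2).+1%:R^-1).
  split.
    move=> n; case: ifPn => on y z.
      by move=> -> ->; rewrite subrr normr0 ltW.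
    rewrite /ball/= => yq zq; have := gP n./2.
    rewrite (_ : n./2.*2 = n); last by have := odd_double_half n; rewrite (negbTE on).
    have := ler_distD (q n./2) y z; rewrite (distrC y (q _)).
    set r := _^-1 in yq zq *; lra.
  move=> _ [w Ww <-].
  have [wv|wv] := pselect (lt w v).
    have [|n _ un] := uC (x w); first by exists w.
    by exists n.*2.+1 => //=; rewrite odd_double/= uphalf_double un.
  have Zw : Z w (real_code R g).
    by have [//|->//|vw] := tri w v; apply: mZ vw _ Zv.
  have [_ /(_ _ Zw)[/(_ _ erefl)[n _ xn] _]] := xP w Ww.
  by exists n.*2 => //=; rewrite odd_double doubleK.
(* Each [x w] lies in some [Z v]. Were the set of these points countable, one [w] would exceed all
   the chosen [v], and [x w] would lie in [Z w], contrary to its choice. *)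
pose B l := [set v | W v /\ Z v l].
have /choice[b bP] : forall l, exists v, (x @` W) l -> B l v.
  move=> l; have [[w Ww <-]|nl] := pselect ((x @` W) l).
    by have [v Wv Zv] := Zcov _ (xP w Ww).1; exists v.
  have [w _] : W !=set0.
    by apply/set0P/negP => /eqP W0; apply: ncW; rewrite W0.
  by exists w.
have [||w Ww wb] := @omega1_bound _ W lt (b @` (x @` W)) Wlt.
- by move=> _ [l Ll <-]; have [] := bP l Ll.
- exact: image_countable.
have Lw : (x @` W) (x w) by exists w.
have [Wb Zb] := bP _ Lw.
have lbw : lt (b (x w)) w by apply: wb; exists (x w).
by have [_ /(_ _ (mZ _ _ Wb Ww lbw _ Zb))[_]] := xP w Ww.
Qed.

Lemma BC1_BC2 : BC1 R -> BC2 R.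
Proof.
move=> bc T d md smz; apply: contrapT => ncT.
have [W [lt [_ Wlt]]] := exists_omega1_like ncT.
have [ncW _ tri tr cI] := Wlt.
have [d0 deq dC dT] := md.
have [p _] : [set: T] !=set0.
  by apply/set0P/negP => /eqP T0; apply: ncT; rewrite T0.
(* One point is picked from each nonempty member of the covers by sets of diameter at most
   [k.+1%:R^-1]; the default [p] serves the empty members. *)
have [x xdense] : exists x : nat -> T, forall y e, 0 < e -> exists n, d (x n) y < e.
  have /choice[U UP] : forall k : nat, exists U : nat -> set T,
      (forall n, diam_le d (U n) k.+1%:R^-1) /\ [set: T] `<=` \bigcup_n U n.
    move=> k; have [//|U [Ud TU]] := smz (fun=> k.+1%:R^-1).
    by exists U; split=> // n; have [] := Ud n.
  have /choice[z zP] : forall kn : nat * nat, exists z, forall y,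
      U kn.1 kn.2 y -> U kn.1 kn.2 z.
    move=> kn; have [[y Uy]|nU] := pselect (U kn.1 kn.2 !=set0); first by exists y.
    by exists p => y Uy; exfalso; apply: nU; exists y.
  exists (fun m => z (odflt (0, 0)%N (unpickle m))).
  move=> y e e0; have [k ke] := exists_natSinv_lt e0.
  have [Ud /(_ y I)[n _ Uy]] := UP k.
  exists (pickle (k, n)); rewrite pickleK/=; apply: le_lt_trans ke.
  by apply: (Ud n) => //; exact: (zP (k, n) y).
pose f y (n : nat) : R := Num.min 1 (d (x n) y).
have fB y : bounded_by 1 (f y).
  by move=> n; rewrite ger0_norm /f ?le_min ?ler01 ?d0// ge_min lexx.
have fL y z n : `|f y n - f z n| <= d y z.
  have := dT (x n) y z; have := dT (x n) z y; rewrite (dC z y) ler_norml /f.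
  by case: (leP 1 (d (x n) y)); case: (leP 1 (d (x n) z)); lra.
have fLB y z : bounded_by (d y z) (fun n => f y n - f z n) by move=> n; exact: fL.
have fsep y z : y <> z -> exists n, f y n - f z n <> 0.
  move=> yz; have yz0 : 0 < d y z.
    by rewrite lt0r d0 andbT; apply/eqP => /deq.
  (* The bound 1/2 keeps [f z n] below the truncation level 1, and the bound [d y z / 2] puts [x n]
     strictly nearer to [z] than to [y]. *)
  have [|n nz] := xdense z (Num.min (1 / 2) (d y z / 2)).
    by rewrite lt_min; apply/andP; split; lra.
  exists n; move: nz; rewrite /f lt_min => /andP[n1 n2].
  have := dT y (x n) z; rewrite (dC y (x n)).
  by case: (leP 1 (d (x n) y)); case: (leP 1 (d (x n) z)); lra.
pose le v w := v = w \/ lt v w.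
(* The parameters at which two points of [W] up to [w] are identified. A parameter in no [Z w] would
   make the map injective on [W], with a countable image by [bc]. *)
pose Z w := [set t | pos_le_third t /\ exists v v', [/\ W v /\ le v w, W v' /\ le v' w,
  v <> v' & psum t (f v) = psum t (f v')]].
apply: (@no_omega1_cover T W lt Z bc Wlt).
- move=> w Ww.
  have cle : countable [set v | W v /\ le v w].
    apply: (@subset_countable _ _ (\bigcup_b (if b then [set w] else
        [set v | W v /\ lt v w]))).
      by move=> v [Wv [vw|vw]]; [exists true|exists false].
    by apply: bigcup_countable => // -[] _ //; exact: cI.
  apply: (@subset_countable _ _ (\bigcup_(p in
      [set v | W v /\ le v w] `*` [set v | W v /\ le v w])
    [set t | p.1 <> p.2 /\ pos_le_third t /\ psum t (fun n => f p.1 n - f p.2 n) = 0])).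
    move=> t [st [v [v' [Wv Wv' vv' e]]]]; exists (v, v') => //; split=> //.
    by split=> //; rewrite (psumB st (fB v) (fB v')) e subrr.
  apply: bigcup_countable; first exact: countableX.
  move=> [v v'] _ /=; have [->|vv'] := pselect (v = v').
    by apply: subset_countable (@countable0 R) => t [].
  apply: subset_countable (psum_zeros_countable (fLB v v') (fsep _ _ vv')).
  by move=> t [].
- move=> v w Wv Ww vw t [st [u [u' [[Wu lu] [Wu' lu'] uu' e]]]]; split=> //.
  exists u, u'; split=> //; split=> //; right.
    by case: lu => [->//|/tr]; exact.
  by case: lu' => [->//|/tr]; exact.
- move=> t st; apply: contrapT => nZ; apply: ncW.
  apply: (@countable_image_inj _ _ (fun y => psum t (f y))).
    move=> v v' /set_mem Wv /set_mem Wv' e; apply: contrapT => vv'; apply: nZ.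
    have [w [Ww vw v'w]] : exists w, [/\ W w, le v w & le v' w].
      have [l|//|l] := tri v v'.
      + by exists v'; split=> //; [right|left].
      + by exists v; split=> //; [left|right].
    by exists w => //; split=> //; exists v, v'.
  apply: bc; apply: (@strong_measure_zero_lipschitz _ _ _ d _ (3 / 2) _ setT) => //.
    exact: is_metric_dist.
  move=> y z; rewrite -(psumB st (fB y) (fB z)).
  exact: psum_bound.
Qed.

Lemma BC2_countable T (d : T -> T -> R) (X : set T) :
  BC2 R -> is_metric d -> strong_measure_zero d X -> countable X.
Proof.
move=> bc [d0 deq dC dT] smz.
pose dX (x y : {x | X x}) := d (sval x) (sval y).
have mdX : is_metric dX.
  split=> [x y|x y|x y|x y z]; [exact: d0| |exact: dC|exact: dT].
  split=> [/deq|->]; last exact/deq.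
  by case: x y => [x Xx] [y Xy] /= xy; exact: eq_exist.
have -> : X = sval @` [set: {x | X x}].
  by apply/seteqP; split=> [x Xx|_ [[x Xx] _ <-]//]; exists (exist _ x Xx).
apply: image_countable; apply: (bc _ dX mdX).
apply: (@strong_measure_zero_covers R _ dX setT mdX) => eps eps0.
have [U [Ud XU]] := smz eps eps0.
exists (fun n => sval @^-1` U n); split.
  by move=> n x y Ux Uy; have [_] := Ud n; exact.
by move=> [x Xx] _; have [n _ Ux] := XU x Xx; exists n.
Qed.

Lemma BC2_BC1 : BC2 R -> BC1 R.
Proof. by move=> bc X; apply: BC2_countable bc (is_metric_dist R). Qed.

End MetricSpaces.

(** * Topological groups *)

Section TopologicalGroups.
Variable R : realType.

(** * The left uniformity of a topological group and its metrization *)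

Section LeftUniformity.
Variables (G : topologicalType) (mul : G -> G -> G) (inv : G -> G) (e : G).
Hypothesis Ggrp : is_topological_group mul inv e.

Let mulA x y z : mul x (mul y z) = mul (mul x y) z.
Proof. by case: Ggrp. Qed.
Let mule x : mul e x = x.
Proof. by case: Ggrp => _ /(_ x)[]. Qed.
Let emul x : mul x e = x.
Proof. by case: Ggrp => _ /(_ x)[]. Qed.
Let mulVx x : mul (inv x) x = e.
Proof. by case: Ggrp => _ _ /(_ x)[]. Qed.
Let mulxV x : mul x (inv x) = e.
Proof. by case: Ggrp => _ _ /(_ x)[]. Qed.
Let mulKV x y : mul x (mul (inv x) y) = y.
Proof. by rewrite mulA mulxV mule. Qed.
Let mulVK x y : mul (inv x) (mul x y) = y.
Proof. by rewrite mulA mulVx mule. Qed.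
Let inve : inv e = e.
Proof. by rewrite -[RHS](mulVx e) emul. Qed.
Let invMV x y : inv (mul (inv x) y) = mul (inv y) x.
Proof.
have h : mul (mul (inv x) y) (mul (inv y) x) = e by rewrite -mulA mulKV mulVx.
by rewrite -[LHS]emul -h mulVK.
Qed.

Let mul_nbhs x y A : nbhs (mul x y) A ->
  exists P Q, [/\ nbhs x P, nbhs y Q & forall u v, P u -> Q v -> A (mul u v)].
Proof.
case: Ggrp => _ _ _ /(_ (x, y)) cm _ /cm [[P Q] /= [Px Qy] PQ].
by exists P, Q; split=> // u v Pu Qv; apply: (PQ (u, v)).
Qed.

Let lmul_nbhs x y A : nbhs (mul x y) A -> nbhs y [set v | A (mul x v)].
Proof.
move=> /mul_nbhs[P [Q [Px Qy PQ]]]; apply: filterS Qy => v Qv.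
by apply: PQ => //; exact: nbhs_singleton.
Qed.

Definition left_entourage : set_system (G * G) :=
  filter_from (nbhs e) (fun U => [set p | U (mul (inv p.1) p.2)]).

Let left_entourage_filter : Filter left_entourage.
Proof.
apply: filter_from_filter; first by exists setT; exact: filterT.
by move=> U V Ue Ve; exists (U `&` V); [exact: filterI|].
Qed.

Let left_entourage_diagonal A : left_entourage A -> diagonal `<=` A.
Proof.
move=> [U Ue UA] [x y] /= xy; apply: UA => /=; rewrite /diagonal/= in xy.
by rewrite xy mulVx; exact: nbhs_singleton.
Qed.

Let left_entourage_inv A :
  left_entourage A -> left_entourage (A^-1)%relation.
Proof.
move=> [U Ue UA]; exists [set u | U (inv u)].
  by case: Ggrp => _ _ _ _ ci; apply: ci; rewrite inve.
by move=> [x y] /=; rewrite invMV => h; apply: (UA (y, x)).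
Qed.

Let left_entourage_split A : left_entourage A ->
  exists2 B, left_entourage B & (B \; B)%relation `<=` A.
Proof.
move=> [U Ue UA]; have [|P [Q [Pe Qe PQ]]] := @mul_nbhs e e U.
  by rewrite emul.
exists [set p | (P `&` Q) (mul (inv p.1) p.2)].
  by exists (P `&` Q) => //; exact: filterI.
move=> [x y] [z /= [Pz _] [_ Qz]]; apply: UA => /=.
by rewrite -[y](mulKV z) mulA; exact: PQ.
Qed.

Let left_entourage_nbhs : nbhs = nbhs_ left_entourage.
Proof.
rewrite predeq2E => x A; split.
  move=> xA; exists [set p | A (mul x (mul (inv p.1) p.2))].
    exists [set u | A (mul x u)] => //.
    by apply: lmul_nbhs; rewrite emul.
  by move=> y /xsectionP /=; rewrite mulKV.
move=> [E [U Ue UE] EA]; apply: (@filterS _ _ _ [set y | U (mul (inv x) y)]).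
  by move=> y Uy; apply: EA; apply/xsectionP; exact: (UE (x, y)).
by apply: lmul_nbhs; rewrite mulVx.
Qed.

Lemma left_invariant_metric : hausdorff_space G -> @second_countable G ->
  exists d : G -> G -> R, is_metric d /\
  forall eps, 0 < eps -> exists U, (open U /\ U e) /\
    forall x u, U u -> d x (mul x u) <= eps.
Proof.
move=> hG [B cB [Bo Bb]].
pose mx := Nbhs_isUniform_mixin.Build G left_entourage_filter
  left_entourage_diagonal left_entourage_inv left_entourage_split
  left_entourage_nbhs.
pose UT : uniformType := HB.pack G mx.
have cu : countable_uniformity UT.
  exists [set [set p : UT * UT | U (mul (inv p.1) p.2)] | U in [set U | B U /\ U e]].
  split.
  - by apply: image_countable; apply: subset_countable cB => U [].
  - move=> _ [U [BU Ue] <-]; exists U => //.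
    by apply: open_nbhs_nbhs; split=> //; exact: Bo.
  - move=> P [U Ue UP]; have [V [BV Ve] VU] := Bb e U Ue.
    exists [set p | V (mul (inv p.1) p.2)]; first by exists V.
    by move=> p Vp; apply: UP; exact: VU.
pose PT : pseudoMetricType R := countable_uniform.type cu.
pose d (x y : PT) : R := fine (edist (x, y)).
(* The whole space is a ball of radius 2, so the extended distance is finite. *)
have dfin (x y : PT) : edist (x, y) \is a fin_num.
  rewrite ge0_fin_numE ?edist_ge0//; apply: (@le_lt_trans _ _ 2%:E); last exact: ltry.
  by apply: edist_fin => //=; exact: countable_uniform.countable_uniform_bounded.
have dE x y : (d x y)%:E = edist (x, y) by rewrite /d fineK.
exists d; split.
  split=> [x y|x y|x y|x y z].
  - by apply: fine_ge0; exact: edist_ge0.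
  - split=> [dxy|->]; last by rewrite /d edist_refl.
    apply: hG => P Q xP yQ.
    have : nbhs (x : PT) P by [].
    move=> /nbhs_ballP[r /= r0 rP]; exists y; split; last exact: nbhs_singleton.
    by apply: rP; apply: (@edist_lt_ball _ _ r (x : PT, y)); rewrite -dE dxy lte_fin.
  - by rewrite /d edist_sym.
  - by rewrite -lee_fin EFinD !dE; exact: edist_triangle.
move=> eps eps0.
have [U Ue UE] : @entourage PT [set p | ball p.1 eps p.2].
  by rewrite -entourage_ballE; exists eps.
exists U°; split; first by split; [exact: open_interior|exact: nbhs_singleton (nbhs_interior Ue)].
move=> x u /interior_subset Uu; rewrite -lee_fin dE; apply: edist_fin => //.
by apply: (UE (x, _)); rewrite /= mulVK.
Qed.

End LeftUniformity.

(** If all products [mul x u] with [u] in [U n] are within [eps n / 2] of [x], left translates of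
    [U n] have diameter at most [eps n]; Rothberger boundedness thus becomes strong measure zero. *)
Lemma BC1_BC3 : BC1 R -> BC3.
Proof.
move=> /BC1_BC2 bc G mul inv e Gg [hG _] scG X rX.
have [d [md dU]] := left_invariant_metric Gg hG scG.
apply: (BC2_countable bc md); apply: strong_measure_zero_covers => // eps eps0.
have /choice[U UP] : forall n, exists U, (open U /\ U e) /\
    forall x u, U u -> d x (mul x u) <= eps n / 2.
  by move=> n; apply: dU; rewrite divr_gt0.
have [|g gX] := rX U; first by move=> n; have [] := UP n.
exists (fun n => [set mul (g n) u | u in U n]); split=> // n _ _ [u Uu <-] [v Uv <-].
have [_ UE] := UP n; have [_ _ dC dT] := md.
have := UE (g n) _ Uu; have := UE (g n) _ Uv.
by have := dT (mul (g n) u) (g n) (mul (g n) v); rewrite (dC _ (g n)); lra.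
Qed.

Lemma second_countable_real : @second_countable R^o.
Proof.
pose B (p : rat * nat) : set R^o := ball (ratr p.1 : R^o) p.2.+1%:R^-1.
exists (range B); first exact: image_countable.
split; first by move=> _ [p _ <-]; exact: ball_open.
move=> x A /nbhs_ballP[r /= r0 rA].
have [n nr] := @exists_natSinv_lt R (r / 2) (divr_gt0 r0 (ltr0Sn _ _)).
have [||y [yx [p _ py]]] := @dense_rat R (ball x n.+1%:R^-1).
- by exists x; apply: ballxx.
- exact: ball_open.
exists (B (p, n)); last first.
  move=> z; rewrite /B/= py => yz; apply: rA.
  have := ball_triangle yx yz; apply: le_ball.
  by set s := _^-1 in nr *; lra.
by split; [exists (p, n)|rewrite /B/= py; exact: ball_sym].
Qed.

Lemma BC3_BC1 : BC3 -> BC1 R.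
Proof.
move=> bc X smz.
apply: (bc R^o (fun x y => x + y) (fun x => - x) 0).
- split=> [x y z|x|x| |].
  + exact: addrA.
  + by rewrite add0r addr0.
  + by rewrite addNr subrr.
  + exact: add_continuous.
  + exact: opp_continuous.
- by split; [exact: norm_hausdorff|exact: (@uniform_completely_regular R)].
- exact: second_countable_real.
move=> U UP.
have /choice[r rP] : forall n, exists r, 0 < r /\ ball (0 : R^o) r `<=` U n.
  move=> n; have [oU U0] := UP n.
  have /nbhs_ballP[r /= r0 rU] : nbhs (0 : R^o) (U n) by exact: open_nbhs_nbhs.
  by exists r.
have [|V [Vd XV]] := smz (fun n => r n / 2).
  by move=> n; rewrite divr_gt0//; have [] := rP n.
(* A nonempty set of diameter at most [r n / 2] lies in the ball of radius [r n] around any of its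
   points; 0 is the default for an empty [V n]. *)
exists (fun n => xget 0 (V n)) => x Xx.
have [n _ Vx] := XV x Xx; exists n => //.
exists (x - xget 0 (V n)); last by rewrite addrC subrK.
have [r0 rU] := rP n; apply: rU; rewrite /ball/= sub0r normrN.
have [_ Vdn] := Vd n.
have := Vdn _ _ Vx (xgetPex 0 (ex_intro _ x Vx)); lra.
Qed.

Lemma BC1_BC4 : BC1 R -> BC4 R.
Proof.
move=> bc H _ rH; apply: bc.
apply: strong_measure_zero_covers; first exact: is_metric_dist.
move=> eps eps0.
pose D n (c : R) : set 'rV[R^o]_1 := [set v | ball (c : R^o) (eps n / 2) (v 0 0)].
(* A selection from the covers of the first power by balls of radius [eps n / 2] gives sets of
   diameter at most [eps n]. *)
have [|V [VD HV]] := rH 1%N isT (fun n => range (D n)).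
  move=> n; split.
    move=> _ [c _ <-]; apply: (@open_comp _ _ (fun v : 'rV[R^o]_1 => v 0 0)).
      by move=> v _; exact: coord_continuous.
    exact: ball_open.
  move=> v _; exists (D n (v 0 0)); first by exists (v 0 0).
  by apply: ballxx; rewrite divr_gt0.
exists (fun n => [set x | V n (\row_(_ < 1) x)]); split.
  move=> n x y /=; have [c _ <-] := VD n; rewrite /D/= !mxE /ball/= => cx cy.
  by have := ler_distD c x y; rewrite (distrC x c); lra.
by move=> x Hx; have [|n _ Vx] := HV (\row_(_ < 1) x);
  [move=> i; rewrite mxE|exists n].
Qed.

End TopologicalGroups.

(** * Rothberger spaces *)

Lemma rothberger_image (T T' : topologicalType) (f : T -> T') (A : set T) :
  continuous f -> rothberger_subspace A -> rothberger_subspace (f @` A).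
Proof.
move=> cf rA Us UsP.
have [|V [VU AV]] := rA (fun n => [set f @^-1` V | V in Us n]).
  move=> n; have [oU AU] := UsP n; split.
    move=> _ [V UV <-]; apply: open_comp; last exact: oU.
    by move=> x _; exact: cf.
  by move=> x Ax; have [|V UV Vfx] := AU (f x); [exists x|exists (f @^-1` V) => //; exists V].
have /choice[V' V'P] : forall n, exists V', Us n V' /\ f @^-1` V' = V n.
  by move=> n; have [V' UV' e] := VU n; exists V'.
exists V'; split; first by move=> n; have [] := V'P n.
move=> _ [x Ax <-]; have [n _ Vx] := AV x Ax; exists n => //.
by have [_ e] := V'P n; rewrite -e in Vx.
Qed.

Lemma rothberger_bigcup (T : topologicalType) (A : nat -> set T) :
  (forall n, rothberger_subspace (A n)) -> rothberger_subspace (\bigcup_n A n).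
Proof.
move=> rA Us UsP.
have cov k n : (forall V, Us n V -> open V) /\ A k `<=` \bigcup_(V in Us n) V.
  have [oU AU] := UsP n; split=> // x Ax; apply: AU; by exists k.
have [V0 [V0U _]] := rA 0%N Us (cov 0%N).
have /choice[V VP] : forall k, exists V : nat -> set T,
    (forall n, Us (pickle (k, n)) (V n)) /\ A k `<=` \bigcup_n V n.
  by move=> k; apply: (rA k (fun n => Us (pickle (k, n)))) => n; exact: cov.
(* The covers are split into infinitely many subsequences, the [k]-th one serving [A k]. The test
   discards a decoded [m] that is not the code of its pair; such positions receive an arbitrary
   member from [V0]. *)
exists (fun m => if unpickle m is Some (k, n) then
  if pickle (k, n) == m then V k n else V0 m else V0 m); split.
  move=> m; case: (unpickle m) => [[k n]|]; last exact: V0U.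
  by case: eqP => [<-|_]; [exact: (VP k).1|exact: V0U].
move=> x [k _ Ax]; have [n _ Vx] := (VP k).2 x Ax.
by exists (pickle (k, n)) => //; rewrite pickleK eqxx.
Qed.

Lemma rothberger_bigcup_countable (T : topologicalType) I (D : set I)
    (A : I -> set T) : countable D -> D !=set0 ->
  (forall i, D i -> rothberger_subspace (A i)) ->
  rothberger_subspace (\bigcup_(i in D) A i).
Proof.
move=> cD D0 rA; have [u uD] := countable_enum cD D0.
rewrite uD bigcup_image; apply: rothberger_bigcup => n.
by apply: rA; rewrite uD; exists n.
Qed.

Lemma rothberger_countable (T : topologicalType) (A : set T) :
  countable A -> A !=set0 -> rothberger_subspace A.
Proof.
move=> cA A0; have [u ->] := countable_enum cA A0 => Us UsP.
have /choice[V VP] : forall n, exists V, Us n V /\ V (u n).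
  move=> n; have [_ AU] := UsP n; have [|V UV Vu] := AU (u n); first by exists n.
  by exists V.
exists V; split; first by move=> n; have [] := VP n.
by move=> _ [n _ <-]; exists n => //; have [] := VP n.
Qed.

(** The covers of even index are spent on the countable set [C]. Their union [U] leaves only points
    of [B], which the covers of odd index handle. *)
Lemma rothberger_concentrated (T : topologicalType) (A C : set T) :
  C `<=` A -> countable C -> C !=set0 ->
  (forall U, open U -> C `<=` U ->
    exists B, [/\ B `<=` A, rothberger_subspace B & A `<=` U `|` B]) ->
  rothberger_subspace A.
Proof.
move=> CA cC C0 conc Us UsP.
have [|V [VU CV]] := rothberger_countable cC C0 (Us := fun n => Us n.*2).
  by move=> n; have [oU AU] := UsP n.*2; split=> // x /CA; exact: AU.
have [|B [BA rB AB]] := conc (\bigcup_n V n) _ CV.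
  by apply: bigcup_open => n _; have [oU _] := UsP n.*2; apply: oU; exact: VU.
have [|V' [V'U BV']] := rB (fun n => Us n.*2.+1).
  by move=> n; have [oU AU] := UsP n.*2.+1; split=> // x /BA; exact: AU.
exists (fun n => if odd n then V' n./2 else V n./2); split.
  move=> n; rewrite -[in Us n](odd_double_half n); case: (odd n).
    by rewrite add1n; exact: V'U.
  by rewrite add0n; exact: VU.
move=> x /AB[[n _ Vx]|/BV'[n _ V'x]].
  by exists n.*2 => //; rewrite odd_double doubleK.
by exists n.*2.+1 => //=; rewrite odd_double/= uphalf_double.
Qed.

Lemma continuous_mx (T U : topologicalType) m n (f : T -> 'M[U]_(m, n)) :
  (forall i j, continuous (fun x => f x i j)) -> continuous f.
Proof.
move=> cf x A [P Pf PA].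
have : \forall y \near x, forall ij : 'I_m * 'I_n, P ij.1 ij.2 (f y ij.1 ij.2).
  by apply: filter_forall => -[i j] /=; exact: cf (Pf i j).
by apply: filterS => y Py; apply: PA => i j; exact: (Py (i, j)).
Qed.

(** * The subgroup generated by a set of reals *)

Section GeneratedSubgroup.
Variable R : realType.

(** Coefficients are a function of the generator, and [undup] counts each generator once, so that
    combinations over a common list add coefficientwise. *)
Definition zspan (A : set R) : set R := [set x | exists (s : seq R) (c : R -> int),
  (forall a, a \in s -> A a) /\ x = \sum_(a <- undup s) a *~ c a].

Lemma zspan_widen (s s' : seq R) (c : R -> int) : {subset s <= s'} ->
  exists c', \sum_(a <- undup s) a *~ c a = \sum_(a <- undup s') a *~ c' a.
Proof.
move=> ss'; exists (fun a => if a \in s then c a else 0).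
rewrite [RHS](bigID (fun a => a \in s))/= [X in _ + X]big1 ?addr0; last first.
  by move=> a /negbTE ->; rewrite mulr0z.
rewrite -[RHS]big_filter [RHS](perm_big (undup s))/=; last first.
  apply: uniq_perm; [exact/filter_uniq/undup_uniq|exact: undup_uniq|].
  move=> a; rewrite mem_filter !mem_undup; case: (boolP (a \in s)) => //= /ss'.
  by move=> ->.
by apply: eq_big_seq => a; rewrite mem_undup => ->.
Qed.

Lemma zspan_subgroup A : add_subgroup (zspan A).
Proof.
split.
- by exists [::], (fun=> 0); rewrite big_nil.
- move=> x y [s [c [sA ->]]] [s' [c' [s'A ->]]].
  have [|d ->] := @zspan_widen s (s ++ s') c.
    by move=> a; rewrite mem_cat => ->.
  have [|d' ->] := @zspan_widen s' (s ++ s') c'.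
    by move=> a; rewrite mem_cat orbC => ->.
  exists (s ++ s'), (fun a => d a + d' a); split.
    by move=> a; rewrite mem_cat => /orP[/sA|/s'A].
  by rewrite -big_split/=; apply: eq_bigr => a _; rewrite mulrzDr.
- move=> x [s [c [sA ->]]]; exists s, (fun a => - c a); split=> //.
  by rewrite -sumrN; apply: eq_bigr => a _; rewrite mulrNz.
Qed.

Lemma sub_zspan A : A `<=` zspan A.
Proof.
move=> a Aa; exists [:: a], (fun=> 1); split; first by move=> b; rewrite inE => /eqP ->.
by rewrite big_seq1 mulr1z.
Qed.

Lemma zspan_mulrz A x (z : int) : zspan A x -> zspan A (x *~ z).
Proof.
move=> [s [c [sA ->]]]; exists s, (fun a => c a * z); split=> //.
by rewrite mulrz_suml; apply: eq_bigr => a _; rewrite mulrzA.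
Qed.

Let lin n (p : {l & 'M[int]_(l, n)}) (v : 'rV[R^o]_(tag p)) : 'rV[R^o]_n :=
  \row_j \sum_i v 0 i *~ tagged p i j.

(** The coordinates of a vector over the span share one finite list of generators, so the vector is
    the image of a tuple from [A] under an integer matrix. There are only countably many such
    matrices. *)
Lemma zspan_pow n A : @set_pow R n (zspan A) =
  \bigcup_(p : {l & 'M[int]_(l, n)}) (@lin n p @` @set_pow R (tag p) A).
Proof.
have [z0 zD zN] := zspan_subgroup A.
apply/seteqP; split=> [v Hv|_ [p _ [v Av <-]] j]; last first.
  rewrite mxE; elim/big_ind: _ => // i _; apply: zspan_mulrz.
  by apply: sub_zspan; exact: Av.
have /choice[sc scP] : forall i : 'I_n, exists sc : seq R * (R -> int),
    (forall a, a \in sc.1 -> A a) /\ v ord0 i = \sum_(a <- undup sc.1) a *~ sc.2 a.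
  by move=> i; have [s [c h]] := Hv i; exists (s, c).
pose s := flatten [seq (sc i).1 | i <- enum 'I_n].
have /choice[c cP] : forall i : 'I_n, exists c : R -> int,
    v ord0 i = \sum_(a <- undup s) a *~ c a.
  move=> i; have [_ ->] := scP i; apply: zspan_widen => a ai.
  by apply/flattenP; exists (sc i).1 => //; apply: map_f; rewrite mem_enum.
pose t := undup s.
exists (Tagged (fun l => 'M[int]_(l, n)) (\matrix_(i < size t, j < n) c j (nth 0 t i))) => //.
exists (\row_(i < size t) nth 0 t i).
  move=> i; rewrite mxE.
  have : nth 0 t i \in s by rewrite -mem_undup mem_nth.
  by move=> /flattenP[_ /mapP[j _ ->]]; exact: (scP j).1.
apply/rowP => j; rewrite mxE cP (big_nth 0) big_mkord.
by apply: eq_bigr => i _; rewrite !mxE.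
Qed.

Lemma rothberger_zspan A : (forall k, rothberger_subspace (@set_pow R k A)) ->
  forall n, rothberger_subspace (@set_pow R n (zspan A)).
Proof.
move=> rA n; rewrite zspan_pow; apply: rothberger_bigcup_countable.
- exact: countableP.
- by exists (Tagged (fun l => 'M[int]_(l, n)) (0 : 'M[int]_(0, n))).
move=> p _; apply: rothberger_image (rA _).
apply: continuous_mx => i j.
have -> : (fun v => @lin n p v i j) =
  (fun v : 'rV[R^o]_(tag p) => \sum_k v 0 k *~ tagged p k j).
  by apply/funext => v; rewrite mxE.
apply: continuous_big => [|k _ v]; first exact: add_continuous.
have -> : (fun v : 'rV[R^o]_(tag p) => v 0 k *~ tagged p k j) =
  (fun v : 'rV[R^o]_(tag p) => v 0 k * (tagged p k j)%:~R).
  by apply/funext => u; rewrite mulrzr.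
have cc : {for v, continuous (fun u : 'rV[R^o]_(tag p) => u 0 k)}.
  exact: coord_continuous.
by apply: cvgM; [exact: (@nbhs_filter _ v)|exact: cc|exact: (@cvg_cst _ _ _ _ (@nbhs_filter _ v))].
Qed.

End GeneratedSubgroup.

(** * Strong measure zero sets with bounded families of functions *)

(* Equivalent to: every family of functions indexed by [W] is bounded for
   eventual domination; the countable family [h] replaces finite exceptions. *)
Definition sigma_bounded T (W : set T) := forall f : T -> nat -> nat,
  exists h : nat -> nat -> nat, forall w, W w ->
  exists m, forall n, (f w n <= h m n)%N.

Lemma sigma_bounded_count T (W : set T) (I : countType) (f : T -> I -> nat) :
  sigma_bounded W -> exists h : nat -> I -> nat, forall w, W w ->
  exists m, forall i, (f w i <= h m i)%N.
Proof.
move=> bW; have [h hP] := bW (fun w n => if unpickle n is Some i then f w i else 0%N).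
exists (fun m i => h m (pickle i)) => w /hP[m hm]; exists m => i.
by have := hm (pickle i); rewrite pickleK.
Qed.

Section BoundedFamilies.
Variable R : realType.
Implicit Types (W : set R) (v : nat -> R).

Let upd v k (x : R) : nat -> R := fun i => if i == k then x else v i.

(** Tuples are padded with zeros so that all lengths share one type and [upd] can split off the last
    coordinate. *)
Definition seq_pow W k : set (nat -> R) :=
  [set v | (forall i, (i < k)%N -> W (v i)) /\ forall i, (k <= i)%N -> v i = 0].

(** For each fixed last coordinate the induction hypothesis gives a countable bounding family; these
    families, read as functions on pairs and indexed by [W], are bounded once more. *)
Lemma sigma_bounded_pow W k : sigma_bounded W -> sigma_bounded (seq_pow W k).
Proof.
move=> bW; elim: k => [|k IH] f.
  exists (fun _ => f (fun=> 0)) => v [_ v0]; exists 0%N => n.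
  by rewrite (_ : v = fun=> 0)//; apply/funext => i; exact: v0.
have /choice[h hP] := fun x => IH (fun v => f (upd v k x)).
have [H HP] := sigma_bounded_count (fun x (p : nat * nat) => h x p.1 p.2) bW.
exists (fun m n => if unpickle m is Some (m1, m2) then H m1 (m2, n) else 0%N).
move=> v [vW v0].
have [|m2 m2P] := hP (v k) (upd v k 0).
  split=> i ik; rewrite /upd; first by rewrite ltn_eqF//; apply: vW; exact: ltnW.
  by case: eqP => // /eqP ik'; apply: v0; rewrite ltn_neqAle eq_sym ik' ik.
have [m1 m1P] := HP (v k) (vW k (ltnSn k)).
exists (pickle (m1, m2)) => n; rewrite pickleK; apply: leq_trans (m1P (m2, n)) => /=.
have E : upd (upd v k 0) k (v k) = v.
  by apply/funext => i; rewrite /upd; case: eqP => [->|].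
by have := m2P n; rewrite E.
Qed.

Let ep (n : nat) : R := n.+1%:R^-1.

Let ep_gt0 n : 0 < ep n. Proof. by rewrite invr_gt0. Qed.

Let ep_le m n : (m <= n)%N -> ep n <= ep m.
Proof. by move=> mn; rewrite lef_pV2 ?posrE// ler_nat. Qed.

Let small_at (g : nat -> nat) (S : nat -> nat -> set R) :=
  forall n i, diam_le (fun x y : R => `|x - y|) (S n i) (ep (g n)).

(** A single index [n] must catch all coordinates at once: the boxes with sides [S n i] witness
    strong measure zero of the power. *)
Let pow_covers W k := forall g, exists S, small_at g S /\
  forall v, (forall i, (i < k)%N -> W (v i)) ->
  exists n, forall i, (i < k)%N -> S n i (v i).

(** Infinitely many disjoint subsequences of the tolerances, one for each [p], each yield a full
    cover, so every tuple is caught infinitely often. *)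
Let pow_covers_often W k : pow_covers W k -> forall g, exists S, small_at g S /\
  forall v, (forall i, (i < k)%N -> W (v i)) ->
  forall N, exists n, (N <= n)%N /\ forall i, (i < k)%N -> S n i (v i).
Proof.
move=> pc g.
have /choice[S SP] : forall p : nat, exists S,
    small_at (fun q : nat => g (pickle (p, q))) S /\ forall v,
    (forall i, (i < k)%N -> W (v i)) ->
    exists n, forall i, (i < k)%N -> S n i (v i).
  by move=> p; exact: pc.
exists (fun n => if unpickle n is Some (p, q) then
  if pickle (p, q) == n then S p q else fun=> set0 else fun=> set0); split.
  move=> n i; case: (unpickle n) => [[p q]|]; last by [].
  by case: eqP => [<-|_]; [exact: (SP p).1|].
move=> v vW N; have /choice[q qP] : forall p, exists n, forall i, (i < k)%N -> S p n i (v i).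
  by move=> p; exact: (SP p).2.
have [|p Np] := @injective_gtn (fun p => pickle (p, q p)) _ N.
  by move=> p p' /(pcan_inj pickleK)[].
exists (pickle (p, q p)); split; first exact: ltnW.
by move=> i ik; rewrite pickleK eqxx; exact: qP.
Qed.

Lemma strong_measure_zero_pow W : W !=set0 ->
  strong_measure_zero (fun x y : R => `|x - y|) W -> sigma_bounded W ->
  forall k, pow_covers W k.
Proof.
move=> [w0 Ww0] smz bW; elim=> [|k IH] g.
  by exists (fun _ _ => set0); split; [move=> n i x y []|move=> v _; exists 0%N].
have smz1 : pow_covers W 1.
  move=> f; have [//|U [Ud WU]] := smz (fun n => ep (f n)).
  exists (fun n _ => U n); split; first by move=> n _; have [] := Ud n.
  move=> v vW; have [n _ Un] := WU _ (vW 0%N isT); exists n => i.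
  by rewrite ltnS leqn0 => /eqP ->.
have [S [Sd Soft]] := pow_covers_often smz1 g.
(* [f x N] is an index from [N] on at which [S] catches [x]. Boundedness of these functions is what
   synchronizes the last coordinate with the others. *)
have /choice[f fP] : forall x, exists f : nat -> nat, W x ->
    forall N, (N <= f N)%N /\ S (f N) 0%N x.
  move=> x; have [Wx|nW] := pselect (W x); last by exists id.
  have /choice[f fP] := Soft (fun=> x) (fun _ _ => Wx).
  by exists f => _ N; have [Nf /(_ 0%N isT)] := fP N.
have [h hP] := bW f.
pose h' N := (\sum_(m < N.+1) h m N)%N.
have hh' m N : (m <= N)%N -> (h m N <= h' N)%N.
  move=> mN; rewrite /h' (bigD1 (Ordinal (mN : (m < N.+1)%N)))//=.
  exact: leq_addr.
(* The intervals from [H i] to [H i.+1] are so long that a point whose [f] is bounded by [h m] is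
   caught in every one with [m <= i]. *)
pose fix H i := if i is i'.+1 then (maxn (H i') (h' (H i'))).+1 else 0%N.
have HS i : (H i < H i.+1)%N by rewrite /= ltnS leq_maxl.
have Hmono i j : (i <= j)%N -> (H i <= H j)%N.
  move=> /subnK <-; elim: (j - i)%N => [|l IHl]; first by rewrite add0n.
  by rewrite addSn; exact: leq_trans IHl (ltnW (HS _)).
have Hge i : (i <= H i)%N.
  by elim: i => // i IHi; exact: leq_ltn_trans IHi (HS i).
have /choice[idx idxP] : forall n, exists i, (H i <= n < H i.+1)%N.
  elim=> [|n [i /andP[Hin nHi]]]; first by exists 0%N; rewrite leqnn.
  have [e|ne] := eqVneq n.+1 (H i.+1); first by exists i.+1; rewrite -e leqnn e HS.
  by exists i; rewrite (leq_trans Hin)//= ltn_neqAle ne.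
have idx_uniq i n : (H i <= n < H i.+1)%N -> idx n = i.
  move=> /andP[Hin nHi]; have /andP[Hjn nHj] := idxP n.
  apply/eqP; rewrite eqn_leq; apply/andP; split; rewrite leqNgt; apply/negP.
    by move=> /Hmono h1; have := leq_trans nHi (leq_trans h1 Hjn); rewrite ltnn.
  by move=> /Hmono h1; have := leq_trans nHj (leq_trans h1 Hin); rewrite ltnn.
pose G i := (\sum_(n < H i.+1) g n)%N.
have gG n : (g n <= G (idx n))%N.
  have /andP[_ nH] := idxP n; rewrite /G (bigD1 (Ordinal nH))//=.
  exact: leq_addr.
(* Sides for the first [k] coordinates are chosen per interval, fine enough for every tolerance in
   it. They catch the tuple at some [i >= m], and within that interval some [n] catches the last
   coordinate. *)
have [T [Td Toft]] := pow_covers_often IH G.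
exists (fun n c => if (c < k)%N then T (idx n) c else S n 0%N); split.
  move=> n c x y; case: ifP => _; last exact: Sd.
  by move=> Tx Ty; apply: le_trans (Td _ _ _ _ Tx Ty) (ep_le (gG n)).
move=> v vW.
have [m hm] := hP _ (vW k (ltnSn k)).
have [|i [mi Ti]] := Toft v _ m; first by move=> c ck; apply: vW; exact: ltnW.
have [Hf Sf] := fP _ (vW k (ltnSn k)) (H i).
set n := f (v k) (H i) in Hf Sf.
have nH : (n < H i.+1)%N.
  rewrite /= ltnS leq_max; apply/orP; right.
  by apply: leq_trans (hm _) (hh' _ _ _); exact: leq_trans mi (Hge i).
have idxn : idx n = i by apply: idx_uniq; rewrite Hf nH.
exists n => c; rewrite ltnS leq_eqVlt => /orP[/eqP ->|ck].
  by rewrite ltnn.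
by rewrite ck idxn; exact: Ti.
Qed.

Let row_of k (v : nat -> R) : 'rV[R^o]_k := \row_(i < k) v i.

Lemma rothberger_sigma_bounded W : W !=set0 ->
  strong_measure_zero (fun x y : R => `|x - y|) W -> sigma_bounded W ->
  forall k, rothberger_subspace (@set_pow R k W).
Proof.
move=> [w0 Ww0] smz bW k Us UsP.
have Wrow v : (forall i, (i < k)%N -> W (v i)) -> @set_pow R k W (row_of k v).
  by move=> vW i; rewrite mxE; exact: vW.
(* [f v p] measures how small a box around [v] must be to fit into a member of the cover [Us p]. *)
have /choice[f fP] : forall v, exists f : nat -> nat, seq_pow W k v ->
    forall p, exists V, Us p V /\
    forall y : 'rV[R^o]_k, (forall i : 'I_k, `|v i - y 0 i| <= ep (f p)) -> V y.
  move=> v; have [[vW _]|nv] := pselect (seq_pow W k v); last by exists id.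
  suff /choice[f fP] : forall p, exists j V, Us p V /\
      forall y : 'rV[R^o]_k, (forall i : 'I_k, `|v i - y 0 i| <= ep j) -> V y.
    by exists f => _.
  move=> p; have [oU WU] := UsP p; have [V UV Vv] := WU _ (Wrow v vW).
  have /nbhs_ballP[r /= r0 rV] : nbhs (row_of k v) V.
    by apply: open_nbhs_nbhs; split=> //; exact: oU.
  have [j jr] := exists_natSinv_lt r0.
  exists j, V; split=> // y yv; apply: rV; split=> // i0 i.
  by rewrite !ord1 mxE; exact: le_lt_trans (yv i) jr.
have [h hP] := sigma_bounded_pow k bW f.
have /choice[S SP] : forall m : nat, exists S,
    small_at (fun q : nat => h m (pickle (m, q))) S /\ forall v,
    (forall i, (i < k)%N -> W (v i)) ->
    exists n, forall i, (i < k)%N -> S n i (v i).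
  by move=> m; apply: strong_measure_zero_pow => //; exists w0.
(* At [p = pickle (m, q)] one member suits all tuples in the box [S m q] whose [f] is at most
   [h m p]: any one such tuple determines it, and the box is small enough for that tuple. *)
have /choice[V VP] : forall p, exists V, Us p V /\ forall m q, p = pickle (m, q) ->
    forall v, seq_pow W k v -> (f v p <= h m p)%N ->
    (forall i, (i < k)%N -> S m q i (v i)) -> V (row_of k v).
  move=> p; have [oU WU] := UsP p.
  have [V0 UV0 _] := WU _ (Wrow (fun=> w0) (fun _ _ => Ww0)).
  have [[m [q pE]]|np] := pselect (exists m q : nat, p = pickle (m, q)); last first.
    by exists V0; split=> // m q e; exfalso; apply: np; exists m, q.
  have [[v [Wv fv Sv]]|nv] := pselect (exists v, [/\ seq_pow W k v,
      (f v p <= h m p)%N & forall i, (i < k)%N -> S m q i (v i)]); last first.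
    exists V0; split=> // m' q' e v Wv fv Sv; exfalso; apply: nv; exists v.
    have [-> ->] : m = m' /\ q = q'.
      by move: e; rewrite pE => /(pcan_inj pickleK)[].
    by [].
  have [V [UV VV]] := fP v Wv p.
  exists V; split=> // m' q' e u Wu fu Su; apply: VV => i; rewrite mxE.
  have [e1 e2] : m = m' /\ q = q' by move: e; rewrite pE => /(pcan_inj pickleK)[].
  subst m' q'.
  apply: (@le_trans _ _ (ep (h m p))); last exact: ep_le.
  by rewrite pE; apply: (SP m).1; [exact: Sv|exact: Su].
exists V; split; first by move=> p; have [] := VP p.
move=> u uW.
pose v i := if insub i is Some j then u 0 (j : 'I_k) else 0.
have vE (i : 'I_k) : v i = u 0 i by rewrite /v valK.
have Wv : seq_pow W k v.
  split=> i ik; first by rewrite (vE (Ordinal ik)); exact: uW.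
  by rewrite /v insubF// ltnNge ik.
have -> : u = row_of k v by apply/rowP => i; rewrite mxE vE.
have [m hm] := hP v Wv.
have [q Sq] := (SP m).2 v Wv.1.
exists (pickle (m, q)) => //.
by have [_ /(_ m q erefl v Wv)] := VP (pickle (m, q)); apply.
Qed.

End BoundedFamilies.

(** * Scales *)

Definition le_star (f g : nat -> nat) := exists N, forall n, (N <= n)%N -> (f n <= g n)%N.

Definition growing (f : nat -> nat) :=
  (forall n, (n < f n)%N) /\ forall m n, (m <= n)%N -> (f m <= f n)%N.

(** Countability is a premise of the last clause only, so the recursion in [exists_scale] can call
    this before its earlier values are known to be countably many. *)
Lemma exists_dominating (F : set (nat -> nat)) (f : nat -> nat) :
  exists g, [/\ growing g, forall n, (f n <= g n)%N &
    countable F -> forall u, F u -> le_star u g].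
Proof.
have [u Fu] : exists u : nat -> nat -> nat, countable F -> F `<=` range u.
  have [[cF F0]|nF] := pselect (countable F /\ F !=set0).
    by have [u Fu] := countable_enum cF F0; exists u => _; rewrite -Fu.
  exists (fun _ => id) => cF x Fx; exfalso; apply: nF; split=> //; by exists x.
pose b n := (n.+1 + f n + \sum_(i < n.+1) u i n)%N.
pose g n := (\sum_(j < n.+1) b j)%N.
have bg n : (b n <= g n)%N by rewrite /g big_ord_recr/= leq_addl.
exists g; split.
- split=> [n|m n /subnK <-]; first by apply: leq_trans (bg n); rewrite /b -addnA leq_addr.
  elim: (n - m)%N => [|l IH]; first by rewrite add0n.
  by apply: leq_trans IH _; rewrite addSn {2}/g big_ord_recr/= leq_addr.
- by move=> n; apply: leq_trans (bg n); rewrite /b; lia.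
- move=> cF v /(Fu cF)[i _ <-]; exists i => n iN.
  apply: leq_trans (bg n); rewrite /b (bigD1 (Ordinal (iN : (i < n.+1)%N)))//=.
  by rewrite addnCA leq_addr.
Qed.

Section Scale.
Variables (T : Type) (W : set T) (lt : T -> T -> Prop) (f : T -> nat -> nat).
Hypothesis Wlt : omega1_like W lt.

Lemma exists_scale : exists x : T -> nat -> nat,
  [/\ forall w, growing (x w), forall w n, (f w n <= x w n)%N &
      forall v w, W v -> W w -> lt v w -> le_star (x v) (x w)].
Proof.
have [_ wf _ _ cI] := Wlt.
pose fam w (g : forall v, lt v w -> nat -> nat) : set (nat -> nat) :=
  [set u | exists v (h : lt v w), W v /\ u = g v h].
pose step w g := projT1 (cid (exists_dominating (fam w g) (f w))).
pose x := Fix wf (fun _ => nat -> nat) step.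
have xE w : x w = step w (fun v _ => x v).
  rewrite /x Fix_eq// => w' g g' gg'; congr step.
  by apply/functional_extensionality_dep => v; apply/functional_extensionality_dep.
have stepP w : [/\ growing (x w), forall n, (f w n <= x w n)%N &
    countable (fam w (fun v _ => x v)) ->
    forall u, fam w (fun v _ => x v) u -> le_star u (x w)].
  by rewrite xE /step; case: cid.
exists x; split=> [w|w|v w Wv Ww vw]; [by case: (stepP w)..|].
have [_ _] := stepP w; apply; last by exists v, vw.
apply: (@subset_countable _ _ (x @` [set v | W v /\ lt v w])).
  by move=> u [v' [h [Wv' ->]]]; exists v'.
by apply: image_countable; exact: cI.
Qed.

Hypothesis f_unbounded : ~ exists h : nat -> nat -> nat, forall w, W w ->
  exists m, forall n, (f w n <= h m n)%N.

(** Otherwise every [f w] is eventually below [h], and the functions [maxn (h n) m] bound the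
    family, [m] absorbing the finitely many exceptions. *)
Lemma unbounded_often (h : nat -> nat) :
  exists2 w, W w & forall N, exists2 n, (N <= n)%N & (h n < f w n)%N.
Proof.
apply: contrapT => nw; apply: f_unbounded.
exists (fun m n => maxn (h n) m) => w Ww.
have [N hN] : exists N, forall n, (N <= n)%N -> (f w n <= h n)%N.
  apply: contrapT => nN; apply: nw; exists w => // N.
  apply: contrapT => nn; apply: nN; exists N => n Nn; rewrite leqNgt.
  by apply/negP => hf; apply: nn; exists n.
exists (\sum_(i < N) f w i)%N => n; rewrite leq_max.
have [Nn|nN] := leqP N n; first by rewrite hN.
by apply/orP; right; rewrite (bigD1 (Ordinal nN))//= leq_addr.
Qed.

Definition orbit_set (g : nat -> nat) : set nat := range (fun j => iter j g 0%N).

Lemma orbit_set_gap (g : nat -> nat) n p p' : growing g ->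
  orbit_set g p -> orbit_set g p' -> (n <= p)%N -> (p < p')%N -> (g n <= p')%N.
Proof.
move=> [gid gm] [j _ <-] [j' _ <-] np pp'.
have im i : (iter i g 0 < iter i.+1 g 0)%N by exact: gid.
have imono i l : (iter i g 0 <= iter (l + i) g 0)%N.
  by elim: l => // l IH; rewrite addSn; exact: leq_trans IH (ltnW (im _)).
have jj' : (j < j')%N.
  rewrite ltnNge; apply/negP => j'j; move: pp'; rewrite ltnNge => /negP; apply.
  by rewrite -(subnK j'j).
by apply: leq_trans (gm _ _ np) _; rewrite -iterS -(subnK jj').
Qed.

Lemma orbit_set_unbounded (g : nat -> nat) m : growing g ->
  exists2 p, orbit_set g p & (m <= p)%N.
Proof.
move=> [gid _]; exists (iter m g 0%N); first by exists m.
by elim: m => //= m IH; exact: leq_ltn_trans IH (gid _).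
Qed.

(* Beyond [alpha] all the functions of the scale jump over [h2 n] at [n], so each
   orbit has at most one point among the [n.+1] intervals below [h2 n]. *)
Lemma scale_gap (x : T -> nat -> nat) :
  (forall w, growing (x w)) -> (forall w n, (f w n <= x w n)%N) ->
  (forall v w, W v -> W w -> lt v w -> le_star (x v) (x w)) ->
  forall h : nat -> nat, exists2 alpha, W alpha &
  forall N k (w : 'I_k -> T), (forall i, W (w i) /\ ~ lt (w i) alpha) ->
  exists2 m, (N <= m)%N &
    forall i n, (m <= n < h m)%N -> ~ orbit_set (x (w i)) n.
Proof.
move=> xg fx xle h; have [_ _ tri _ _] := Wlt.
(* Iterating [h1] from [n.+1] produces [n.+1] consecutive intervals up to [h2 n], each long enough
   to serve as the gap. *)
pose h1 m := maxn m.+1 (h m).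
pose h2 n := iter n.+1 h1 n.+1.
have [alpha Wa ha] := unbounded_often h2.
exists alpha => // N k w wP.
have /choice[M MP] : forall i, exists N, forall n, (N <= n)%N ->
    (x alpha n <= x (w i) n)%N.
  move=> i; have [Wi nlt] := wP i.
  have [aw|->|wa] := tri alpha (w i); [exact: xle|by exists 0%N|by []].
have [n nbig hn] := ha (N + k + \sum_i M i)%N.
have Nn : (N <= n)%N by apply: leq_trans nbig; rewrite -addnA leq_addr.
have kn : (k <= n)%N by apply: leq_trans nbig; rewrite addnAC leq_addl.
have Mn i : (M i <= n)%N.
  by apply: leq_trans nbig; rewrite (bigD1 i)//= addnCA leq_addr.
have xh i : (h2 n < x (w i) n)%N.
  by apply: leq_trans (MP i n (Mn i)); exact: leq_trans hn (fx _ _).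
have h1gt m : (m < h1 m)%N by rewrite leq_maxl.
have imono c l : (iter c h1 n.+1 <= iter (l + c) h1 n.+1)%N.
  by elim: l => // l IH; rewrite addSn; exact: leq_trans IH (ltnW (h1gt _)).
apply: contrapT => nom.
(* If every interval met an orbit, then, as [k <= n], two would meet the same one. [orbit_set_gap]
   would place the later point at or above [x (w i) n], which exceeds [h2 n]. *)
have /choice[i iP] : forall c : 'I_n.+1, exists i, exists2 p,
    (iter c h1 n.+1 <= p < iter c.+1 h1 n.+1)%N & orbit_set (x (w i)) p.
  move=> c; apply: contrapT => nc; apply: nom; exists (iter c h1 n.+1).
    apply: leq_trans Nn _; apply: leq_trans (leqnSn n) _.
    by have := imono 0%N c; rewrite addn0.
  move=> i p /andP[mp ph] op; apply: nc; exists i, p => //.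
  by rewrite mp/= (leq_trans ph)// leq_maxr.
have : ~ injective i.
  by move=> /leq_card; rewrite !card_ord leqNgt ltnS kn.
apply => c c' icc'; apply/eqP; apply: contrapT => /negP cc'.
have clash (a b : 'I_n.+1) : i a = i b -> (a < b)%N -> False.
  move=> iab ab; have [p /andP[p1 p2] op] := iP a; have [p' /andP[p'1 p'2] op'] := iP b.
  rewrite -iab in op'.
  have pp' : (p < p')%N.
    apply: leq_trans p2 (leq_trans _ p'1).
    by have := imono a.+1 (b - a.+1)%N; rewrite subnK.
  have np : (n <= p)%N.
    apply: leq_trans (leqnSn n) (leq_trans _ p1).
    by have := imono 0%N a; rewrite addn0.
  have := orbit_set_gap (xg _) op op' np pp'.
  rewrite leqNgt => /negP; apply; apply: ltn_trans (xh (i a)).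
  apply: leq_trans p'2 _.
  by have := imono b.+1 (n.+1 - b.+1)%N; rewrite subnK.
by move: cc'; rewrite neq_ltn => /orP[/(clash _ _ icc')|/(clash _ _ (esym icc'))].
Qed.

End Scale.

(** * A set of reals concentrated on the codes of finite sets *)

Section ScaleSet.
Variable R : realType.
Variables (T : Type) (W : set T) (lt : T -> T -> Prop) (x : T -> nat -> nat).
Hypothesis Wlt : omega1_like W lt.
Hypothesis xg : forall w, growing (x w).
Hypothesis xgap : forall h : nat -> nat, exists2 alpha, W alpha &
  forall N k (w : 'I_k -> T), (forall i, W (w i) /\ ~ lt (w i) alpha) ->
  exists2 m, (N <= m)%N &
    forall i n, (m <= n < h m)%N -> ~ orbit_set (x (w i)) n.

Let ltxx w : ~ lt w w.
Proof. by have [_ wf _ _ _] := Wlt; elim: (wf w) => y _ IH yy; exact: (IH y). Qed.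

Let orb w := orbit_set (x w).

Definition scale_set : set R :=
  cantor_real R @` (finite_set `|` orb @` W).

(** A diagonal argument: given an enumeration [u] of the orbits, take [h m] beyond the next element
    from [m] on of each [u i] with [i <= m]. An orbit with gaps for this [h] is no [u i]. *)
Lemma scale_set_uncountable : ~ countable scale_set.
Proof.
move=> cA; have cO : countable (orb @` W).
  apply: (@countable_image_inj _ _ (cantor_real R)).
    by move=> a b _ _; exact: cantor_real_inj.
  by apply: subset_countable cA; apply: image_subset => s; right.
have [u uO] : exists u : nat -> set nat, orb @` W = range u.
  have [alpha Wa _] := xgap id.
  by apply: countable_enum => //; exists (orb alpha), alpha.
have uinf i m : exists2 p, u i p & (m <= p)%N.
  have [w _ <-] : (orb @` W) (u i) by rewrite uO; exists i.
  exact: orbit_set_unbounded.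
have /choice[nx nxP] : forall im : nat * nat, exists p, u im.1 p /\ (im.2 <= p)%N.
  by move=> [i m] /=; have [p up mp] := uinf i m; exists p.
have [alpha Wa ha] := xgap (fun m => \sum_(i < m.+1) (nx (i : nat, m)).+1)%N.
have [i _ ui] : range u (orb alpha) by rewrite -uO; exists alpha.
have [_|m im /(_ ord0) hm] := ha i 1%N (fun=> alpha).
  by split=> //; exact: ltxx.
have [un mn] := nxP (i, m).
apply: (hm (nx (i, m))); last by rewrite -/(orb alpha) -ui.
rewrite mn/= (bigD1 (Ordinal (im : (i < m.+1)%N)))//=.
exact: leq_addr.
Qed.

(** Freezing the coordinates outside [D] allows induction on the number of free ones. *)
Let slice n (D : {set 'I_n}) (c : 'I_n -> R) : set 'rV[R^o]_n :=
  [set v | forall i, if i \in D then scale_set (v 0 i) else v 0 i = c i].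

Let trunc m (S : {set 'I_m}) : set nat := [set p | exists2 i, i \in S & val i = p].

Let trunc_finite m (S : {set 'I_m}) : finite_set (trunc S).
Proof.
apply: (@sub_finite_set _ _ `I_m); last exact: finite_II.
by move=> p [i _ <-] /=; exact: ltn_ord.
Qed.

Let fin_points n (D : {set 'I_n}) (c : 'I_n -> R) : set 'rV[R^o]_n :=
  [set v | exists m (F : {ffun 'I_n -> {set 'I_m}}),
    v = \row_i (if i \in D then cantor_real R (trunc (F i)) else c i)].

(** The slice is concentrated on [fin_points]. Outside an open set containing these, some free
    coordinate takes one of countably many values, and freezing it leaves a slice with fewer free
    coordinates. *)
Lemma rothberger_slice n (D : {set 'I_n}) c : rothberger_subspace (slice D c).
Proof.
move: {2}#|D| (leqnn #|D|) => d; elim: d D c => [|d IH] D c.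
  rewrite leqn0 cards_eq0 => /eqP ->.
  have -> : slice finset.set0 c = [set \row_i c i].
    apply/seteqP; split=> [v sv|_ -> i]; last by rewrite inE mxE.
    by apply/rowP => i; have := sv i; rewrite inE mxE.
  by apply: rothberger_countable => //; exists (\row_i c i).
move=> Dd.
have subC : fin_points D c `<=` slice D c.
  move=> _ [m [F ->]] i; rewrite mxE; case: (i \in D) => //.
  by exists (trunc (F i)) => //; left; exact: trunc_finite.
have countC : countable (fin_points D c).
  apply: (@subset_countable _ _ (\bigcup_m range (fun F : {ffun 'I_n -> {set 'I_m}} =>
      \row_i (if i \in D then cantor_real R (trunc (F i)) else c i) : 'rV[R^o]_n))).
    by move=> _ [m [F ->]]; exists m => //; exists F.
  by apply: bigcup_countable => // m _; exact: image_countable.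
have C_neq0 : fin_points D c !=set0.
  pose F0 : {ffun 'I_n -> {set 'I_0}} := [ffun=> finset.set0].
  by exists (\row_i (if i \in D then cantor_real R (trunc (F0 i)) else c i)), 0%N, F0.
apply: (rothberger_concentrated subC countC C_neq0).
move=> U oU CU.
pose pt m (F : {ffun 'I_n -> {set 'I_m}}) : 'rV[R^o]_n :=
  \row_i (if i \in D then cantor_real R (trunc (F i)) else c i).
have /choice[r rP] : forall mF : {m & {ffun 'I_n -> {set 'I_m}}}, exists r : nat,
    forall v : 'rV[R^o]_n,
    (forall i, `|pt _ (tagged mF) 0 i - v 0 i| <= 3 / 2 * (1 / 3) ^+ r) -> U v.
  move=> [m F] /=.
  have /nbhs_ballP[e /= e0 eU] : nbhs (pt m F) U.
    by apply: open_nbhs_nbhs; split=> //; apply: CU; exists m, F.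
  have : ((fun n => geometric (3 / 2) (1 / 3 : R) n) @ \oo --> (0 : R)).
    by apply: cvg_geometric; rewrite ger0_norm; lra.
  move/cvgrPdist_lt => /(_ e e0)[r _ rP]; exists r => v hv.
  apply: eU; split=> // i0 i; rewrite ord1; apply: le_lt_trans (hv i) _.
  have /= := rP r (leqnn r); rewrite sub0r normrN; apply: le_lt_trans.
  exact: ler_norm.
(* Agreement up to [h m] with any tuple of subsets of ['I_m] on the free coordinates forces
   membership in [U]. *)
pose h m := (\sum_(F : {ffun 'I_n -> {set 'I_m}}) r (Tagged _ F))%N.
have [alpha Wa ha] := xgap h.
pose C := cantor_real R @` (finite_set `|` orb @` [set w | W w /\ lt w alpha]).
have CA : C `<=` scale_set.
  move=> _ [s [fs|[w [Ww _] <-]] <-]; first by exists s => //; left.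
  by exists (orb w) => //; right; exists w.
have cC : countable C.
  apply: image_countable; apply: (@subset_countable _ _ (\bigcup_b
    (if b then [set s : set nat | s `<=` setT /\ finite_set s]
     else orb @` [set w | W w /\ lt w alpha]))).
    by move=> s [fs|os]; [exists true|exists false].
  apply: bigcup_countable => // -[] _; first exact: countable_finite_subset.
  by apply: image_countable; have [_ _ _ _ cI] := Wlt; exact: cI.
have [D0|/set0Pn[i0 i0D]] := eqVneq D finset.set0.
  exists (fin_points D c); split=> //; first exact: rothberger_countable.
  move=> v sv; left; apply: CU; exists 0%N, ([ffun=> finset.set0] : {ffun 'I_n -> {set 'I_0}}).
  by apply/rowP => i; have := sv i; rewrite D0 !mxE inE.
pose B (p : 'I_n * R) := slice (D :\ p.1)
  (fun i => if i == p.1 then p.2 else c i).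
exists (\bigcup_(p in [set p | p.1 \in D /\ C p.2]) B p); split.
- move=> v [[i y] /= [iD Cy] Bv] j; have := Bv j; rewrite /= in_setD1.
  case: (eqVneq j i) => [->|ji] /=; last by [].
  by rewrite iD => ->; exact: CA.
- apply: rothberger_bigcup_countable.
  + apply: (@subset_countable _ _ (setT `*` C)); last exact: countableX.
    by move=> [i y] [].
  + exists (i0, cantor_real R set0); split=> //=; exists set0 => //; left.
    exact: finite_set0.
  + move=> [i y] [/= iD _]; apply: IH.
    by move: Dd; rewrite (cardsD1 i) iD.
move=> v sv.
have [[i [iD Cv]]|nC] := pselect (exists i, i \in D /\ C (v 0 i)).
  right; exists (i, v 0 i) => // j; rewrite /= in_setD1.
  by case: eqVneq => [->|ji] //=; exact: sv.
left.
(* All free coordinates now code orbits not below [alpha]; frozen coordinates receive the dummy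
   index [alpha]. *)
have /choice[w wP] : forall i, exists w, (W w /\ ~ lt w alpha) /\
    (i \in D -> v 0 i = cantor_real R (orb w)).
  move=> i; have := sv i; case: ifP => iD; last first.
    by exists alpha; do 2!split=> //; exact: ltxx.
  move=> [s [fs|[w Ww <-]] vs].
    by exfalso; apply: nC; exists i; split=> //; exists s => //; left.
  exists w; split=> //; split=> // wa; apply: nC; exists i; split=> //.
  by exists (orb w) => //; right; exists w.
have [|m _ hm] := ha 0%N n w; first by move=> i; have [] := wP i.
(* The orbits have no element from [m] up to [h m], so cutting them at [m] changes nothing below
   [h m]. *)
pose F : {ffun 'I_n -> {set 'I_m}} :=
  [ffun i => finset (fun p : 'I_m => `[< orb (w i) p >])].
apply: (rP (Tagged _ F)) => i /=; rewrite mxE.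
have := sv i; case iD: (i \in D) => svi; last first.
  by rewrite svi subrr normr0 mulr_ge0// exprn_ge0.
have [_ /(_ iD) ->] := wP i.
apply: (@le_trans _ _ (3 / 2 * (1 / 3) ^+ h m)); last first.
  rewrite ler_wpM2l// ler_wiXn2l//; [lra..|].
  by rewrite /h (bigD1 F)//= leq_addr.
apply: cantor_real_close => p ph; rewrite ffunE; split.
  by move=> [q]; rewrite inE => /asboolP oq <-.
move=> op; have pm : (p < m)%N.
  by rewrite ltnNge; apply/negP => mp; apply: (hm i p) => //; rewrite mp.
by exists (Ordinal pm) => //; rewrite inE; exact/asboolP.
Qed.

Lemma rothberger_scale_set k : rothberger_subspace (@set_pow R k scale_set).
Proof.
have -> : @set_pow R k scale_set = slice finset.setT (fun=> 0).
  apply/seteqP; split=> v hv i; first by rewrite inE; exact: hv.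
  by have := hv i; rewrite inE.
exact: rothberger_slice.
Qed.

End ScaleSet.

(** * From subgroups back to Borel's Conjecture, and the equivalences *)

Lemma BC4_BC1 (R : realType) : BC4 R -> BC1 R.
Proof.
move=> bc X smz; apply: contrapT => ncX.
have [W [lt [WX Wlt]]] := exists_omega1_like ncX.
have ncW : ~ countable W by case: Wlt.
suff [A ncA rA] : exists2 A : set R, ~ countable A &
    forall k, rothberger_subspace (@set_pow R k A).
  apply: ncA; apply: subset_countable (@sub_zspan R A) _.
  by apply: bc (zspan_subgroup A) _ => n _; exact: rothberger_zspan.
have [bW|/existsNP[f fW]] := pselect (sigma_bounded W).
  exists W => //; apply: rothberger_sigma_bounded => //.
    by apply/set0P/negP => /eqP W0; apply: ncW; rewrite W0.
  rewrite -(image_id W).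
  apply: (@strong_measure_zero_lipschitz _ _ _ _ _ 1 _ _ _ _ _ _ WX smz) => //.
    exact: is_metric_dist.
  by move=> x y; rewrite mul1r.
have [x [xg fx xle]] := exists_scale f Wlt.
have gap := scale_gap Wlt fW xg fx xle.
exists (scale_set W x); first exact: (scale_set_uncountable Wlt xg gap).
exact: (rothberger_scale_set Wlt gap).
Qed.

Theorem theorem8 (R : realType) :
  (BC1 R <-> BC2 R) /\ (BC1 R <-> BC3) /\ (BC1 R <-> BC4 R).
Proof.
split; [|split]; split.
- exact: BC1_BC2.
- exact: BC2_BC1.
- exact: BC1_BC3.
- exact: BC3_BC1.
- exact: BC1_BC4.
- exact: BC4_BC1.
Qed.
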